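(* Let $p$ be a prime with $p\ne 2,3,7$. Then $$\sum_{k=0}^{p-1}\frac{k\binom{2k}k^2\binom{4k}{2k}}{648^k}\equiv\begin{cases}\frac37p-\frac47x^2\pmod{p^2}&\text{if } p\equiv1\pmod 4\text{ and } p=x^2+4y^2 \text{ with } x,y\in\mathbb Z,\\ -\frac p7\pmod{p^2}&\text{if } p\equiv 3\pmod 4,\end{cases}$$ $$\sum_{k=0}^{p-2}\frac{\binom{2k}k^2\binom{4k}{2k}}{648^k(k+1)}\equiv\begin{cases}-\frac{40}3y^2+2p\pmod{p^2}&\text{if } p\equiv1\pmod 4\text{ and } p=x^2+4y^2 \text{ with } x,y\in\mathbb Z,\\ -\frac32R_1(p)-\frac p3\pmod{p^2}&\text{if } p\equiv 3\pmod 4.\end{cases}$$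
   Context: For an odd prime $p$, $R_1(p)=(2p+2-2^{p-1})\binom{(p-1)/2}{[p/4]}^2$, where $[u]$ denotes the greatest integer not exceeding $u$. Congruences modulo $p^r$ between rational numbers with denominators prime to $p$ mean that the difference is $p^r$ times such a rational number. *)

(* Defs.v *)
From HB Require Import structures.
From mathcomp Require Import all_boot all_order all_algebra.
Set Implicit Arguments. Unset Strict Implicit. Unset Printing Implicit Defensive.
Import Order.TTheory GRing.Theory Num.Theory.
Local Open Scope ring_scope.

Definition rat_congr (p r : nat) (a b : rat) : Prop :=
  exists c : rat, a - b = (p ^ r)%N%:R * c /\ coprime `|denq c|%N p.

Definition R1 (p : nat) : rat :=
  ((2 * p + 2)%N%:R - (2 ^ (p - 1))%N%:R) * ('C((p - 1) %/ 2, p %/ 4))%:R ^+ 2.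

Definition S1 (p : nat) : rat :=
  \sum_(k < p) (k * 'C(2 * k, k) ^ 2 * 'C(4 * k, 2 * k))%N%:R / (648 ^ k)%N%:R.

Definition S2 (p : nat) : rat :=
  \sum_(k < p.-1) ('C(2 * k, k) ^ 2 * 'C(4 * k, 2 * k))%N%:R
                  / ((648 ^ k)%N%:R * (k.+1)%:R).

(* Main.v *)
(* Write f(y) and G(w) for the truncations at k < p of sum_k C(2k,k) C(4k,2k) (y/64)^k and
   sum_k C(2k,k)^2 C(4k,2k) (w/64)^k.  Clausen's identity G(y(1-y)) = f(y)^2 holds modulo p^2: with
   C(a,k) C(-1-a,k) in place of C(2k,k) C(4k,2k) / 64^k it is exact for a = 0, ..., p-1, and
   interpolation in a(a+1) gives a factor p^2 at a = -1/4.  Since 1/648 = (1/64) (1/9) (8/9), both sums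
   become quadratic forms in f = f(1/9) and h = f(1/9) + (16/9) f'(1/9).

   Perturb f to T(x) = 2F1(-x/2, (1-x)/2; x+3/2; 1/9), and h likewise to H(x).  At x = N a natural
   number the series terminate and T, H are products of factorials (WZ).  Modulo p^2 the values at
   x = -1/2 are extrapolated linearly from N = (p-1)/2 and N = (3p-1)/2.  This gives f h = p or -p,
   and f^2 or h^2 in terms of C((p-1)/2, [p/4])^2.  For p = 1 mod 4 the binomial coefficient is
   evaluated modulo p^2 (Chowla, Dwork, Evans) through a quartic Jacobi sum A + B i with
   A^2 + B^2 = p. *)

Require Import Defs.
From HB Require Import structures.
From mathcomp Require Import all_boot all_order all_algebra.
From mathcomp Require Import cyclic zify ring lra.
Set Implicit Arguments. Unset Strict Implicit. Unset Printing Implicit Defensive.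
Import Order.TTheory GRing.Theory Num.Theory.
Local Open Scope ring_scope.

(** * WZ recurrences and closed forms *)

(** Two requirements dictate the direction of the perturbation. At x = -1/2 + c p/2 the denominators
    2x + 2j + 3 = 2 (j + 1) + c p are prime to p for j + 1 < p, so all quantities are affine in c
    modulo p^2. For odd c > 0 the parameter is a natural number, and the series ends before k = p
    exactly for c = 1 and c = 3; this leads to 2 g(0) = 3 g(1) - g(3). Only f h, f^2 and h^2 occur
    in the answer, and it is these that are extrapolated: powers such as (8/3)^((p-1)/2) are known
    modulo p only up to sign, while their squares have the form 1 + p z. Since f h is p or -p, it
    suffices to find the square that is a unit, f^2 for p = 1 mod 4 and h^2 for p = 3 mod 4; the
    other square is then 0. For Clausen's identity the obstacle is that a power series solution of
    the differential equation is determined only after division by (j + 1)^3, whereas the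
    polynomials have degree beyond p. The equation is therefore solved over the rationals, at
    parameters where the truncations are exact, and the passage to Z/p^2 is made by
    interpolation. *)

Definition trm (K : comUnitRingType) (x : K) (k : nat) : K :=
  \prod_(j < k) ((x - 2%:R * j%:R) * (x - (2%:R * j%:R + 1))
                 / (18%:R * (2%:R * x + 2%:R * j%:R + 3%:R) * (j%:R + 1))).

Definition Tsum (K : comUnitRingType) (N : nat) (x : K) : K := \sum_(k < N) trm x k.

(** At x = -1/2 the weight is 16 k + 1, so the sum specialises to h. The dependence of the weight on
    x is chosen so that the two-term recurrence [Hsum_rec] holds. *)
Definition Hsum (K : comUnitRingType) (N : nat) (x : K) : K :=
  \sum_(k < N) (16%:R * k%:R + 10%:R * x + 6%:R) * trm x k.

Lemma trmS (K : comUnitRingType) (x : K) k :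
  trm x k.+1 = trm x k * ((x - 2%:R * k%:R) * (x - (2%:R * k%:R + 1))
                 / (18%:R * (2%:R * x + 2%:R * k%:R + 3%:R) * (k%:R + 1))).
Proof. by rewrite /trm big_ord_recr. Qed.

Lemma trm0 (K : comUnitRingType) (x : K) : trm x 0 = 1.
Proof. by rewrite /trm big_ord0. Qed.

Section SumRecurrences.

Variable F : realFieldType.

Lemma trm_eq0 (N k : nat) : (N < 2 * k)%N -> trm (N%:R : F) k = 0.
Proof.
move=> h; rewrite /trm.
have lt : (N./2 < k)%N by lia.
rewrite (bigD1 (Ordinal lt)) //=.
have /orP[/eqP e|/eqP e] : (N%:R == 2 * N./2%:R :> F) || (N%:R == 2 * N./2%:R + 1 :> F).
- by rewrite -[N in N%:R]odd_double_half -mul2n; case: odd; rewrite natrD natrM ?addr0;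
    [rewrite addrC eqxx orbT | rewrite add0r eqxx].
- by rewrite {1}e subrr !mul0r.
- by rewrite {2}e subrr mulr0 !mul0r.
Qed.

Lemma trm_mulS (x : F) k : 0 <= x ->
  18 * (2 * x + 2 * k%:R + 3) * (k%:R + 1) * trm x k.+1
  = (x - 2 * k%:R) * (x - (2 * k%:R + 1)) * trm x k.
Proof.
move=> x0; rewrite trmS; have : 0 <= k%:R :> F by rewrite ler0n.
move: (k%:R : F) => y y0; field.
by apply/andP; split; lra.
Qed.

(** The quotient of the two terms is rational in x and k. Cleared of denominators, it allows both
    sides of the recurrences below to be expressed through [trm (x + 2) k]. *)
Lemma trm_shift (N : nat) k (x := N%:R : F) (y := k%:R : F) :
  trm x k * ((x + 1) * (x + 2) * (2 * x + 3) * (2 * x + 5))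
  = trm (x + 2) k * ((x + 2 - 2 * y) * (x + 1 - 2 * y)
     * (2 * x + 3 + 2 * y) * (2 * x + 5 + 2 * y)).
Proof.
rewrite /x /y {x y}.
have x0 : 0 <= N%:R :> F by rewrite ler0n.
move: N%:R x0 => x x0.
elim: k => [|k IH]; first by rewrite !trm0; ring.
rewrite !trmS.
have y0 : 0 <= k%:R :> F by rewrite ler0n.
move: (trm x k) (trm (x + 2) k) IH => a b.
rewrite -[k.+1]addn1 natrD.
move: (k%:R : F) y0 => y y0 IH.
have -> : a * ((x - 2 * y) * (x - (2 * y + 1)) / (18 * (2 * x + 2 * y + 3) * (y + 1))) *
  ((x + 1) * (x + 2) * (2 * x + 3) * (2 * x + 5)) =
   a * ((x + 1) * (x + 2) * (2 * x + 3) * (2 * x + 5)) *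
   ((x - 2 * y) * (x - (2 * y + 1)) / (18 * (2 * x + 2 * y + 3) * (y + 1))) by ring.
rewrite IH; field.
apply/and3P; split; lra.
Qed.

Lemma telescope_sum (u G : nat -> F) K :
  (forall k, (k < K)%N -> u k = G k.+1 - G k) -> \sum_(k < K) u k = G K - G 0%N.
Proof.
by move=> H; rewrite -(big_mkord xpredT u) (@telescope_sumr_eq _ 0 K G u) // => k /andP [_ /H].
Qed.

(* [q] in the next two proofs is the Zeilberger certificate. *)
Lemma Tsum_rec (N K : nat) : (N + 2 < 2 * K)%N ->
  27 * (3 * N%:R + 5) * (3 * N%:R + 7) * Tsum K (N.+2%:R : F)
  = 64 * (2 * N%:R + 3) * (2 * N%:R + 5) * Tsum K (N%:R : F).
Proof.
move=> NK; apply/eqP; rewrite -subr_eq0; apply/eqP.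
have N2 : N.+2%:R = N%:R + 2 :> F by rewrite -addn2 natrD.
pose x := N%:R : F.
have x0 : 0 <= x by rewrite ler0n.
pose q (y : F) := (2 * x + 5 + 2 * y) * y * 18
  * (- (26 * x ^+ 2 + 88 * x + 78) - 16 * (1 + x) * y + 64 * y ^+ 2).
(* The factor (x + 1)(x + 2) completes the left side of [trm_shift], so that u k becomes a
   polynomial multiple of [trm (x + 2) k]; it is cancelled at the end. *)
pose u (k : nat) := 2 * (27 * (3 * x + 5) * (3 * x + 7) * (x + 1) * (x + 2) * trm (x + 2) k
   - 64 * (2 * x + 3) * (2 * x + 5) * (x + 1) * (x + 2) * trm x k).
have : \sum_(k < K) u k = 0.
  rewrite (@telescope_sum u (fun k => q k%:R * trm (x + 2) k)).
    by rewrite /= -[x + 2]N2 trm_eq0 /q; [ring | lia].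
  move=> k _; rewrite /u.
  have E := trm_shift N k; rewrite -/x in E.
  have -> : 64 * (2 * x + 3) * (2 * x + 5) * (x + 1) * (x + 2) * trm x k =
    64 * (trm x k * ((x + 1) * (x + 2) * (2 * x + 3) * (2 * x + 5))) by ring.
  have x2 : 0 <= x + 2 by lra.
  have S := trm_mulS k x2.
  have -> : k.+1%:R = k%:R + 1 :> F by rewrite -[k.+1]addn1 natrD.
  (* [q] contains the denominator 18 (2x + 5 + 2y) y of the term ratio, so its value at k + 1 times
     the next term is a polynomial times the current one. *)
  transitivity ((- (26 * x ^+ 2 + 88 * x + 78) - 16 * (1 + x) * (k%:R + 1) + 64 * (k%:R + 1) ^+ 2)
    * (18 * (2 * (x + 2) + 2 * k%:R + 3) * (k%:R + 1) * trm (x + 2) k.+1) - q k%:R * trm (x + 2) k); first by rewrite E S /q; ring.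
  by rewrite /q; ring.
rewrite /u -mulr_sumr sumrB -!mulr_sumr -/(Tsum _ _) -/(Tsum _ _) => E.
rewrite N2 -/x.
have /mulfI h : (x + 1) * (x + 2) != 0 by rewrite mulf_neq0 //; lra.
apply: h; rewrite mulr0.
have /mulfI h2 : (2 : F) != 0 by rewrite pnatr_eq0.
by apply: h2; rewrite mulr0 -[RHS]E; ring.
Qed.

Lemma Hsum_rec (N K : nat) : (N + 2 < 2 * K)%N ->
  27 * (3 * N%:R + 2) * (3 * N%:R + 4) * Hsum K (N.+2%:R : F)
  = 64 * (2 * N%:R + 3) * (2 * N%:R + 5) * Hsum K (N%:R : F).
Proof.
move=> NK; apply/eqP; rewrite -subr_eq0; apply/eqP.
have N2 : N.+2%:R = N%:R + 2 :> F by rewrite -addn2 natrD.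
pose x := N%:R : F.
have x0 : 0 <= x by rewrite ler0n.
pose q (y : F) := (2 * x + 5 + 2 * y) * y * 18
  * (- 260 * x ^+ 3 - 620 * x ^+ 2 - 296 * x + 96 - (576 * x ^+ 2 + 1984 * x + 1664) * y
     + (384 * x + 256) * y ^+ 2 + 1024 * y ^+ 3).
pose u (k : nat) := 2 * (27 * (3 * x + 2) * (3 * x + 4) * (x + 1) * (x + 2)
     * ((16 * k%:R + 10 * (x + 2) + 6) * trm (x + 2) k)
   - 64 * (2 * x + 3) * (2 * x + 5) * (x + 1) * (x + 2)
     * ((16 * k%:R + 10 * x + 6) * trm x k)).
have : \sum_(k < K) u k = 0.
  rewrite (@telescope_sum u (fun k => q k%:R * trm (x + 2) k)).
    by rewrite /= -[x + 2]N2 trm_eq0 /q; [ring | lia].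
  move=> k _; rewrite /u.
  have E := trm_shift N k; rewrite -/x in E.
  have -> : 64 * (2 * x + 3) * (2 * x + 5) * (x + 1) * (x + 2) * ((16 * k%:R + 10 * x + 6) * trm x k) =
    64 * (16 * k%:R + 10 * x + 6) * (trm x k * ((x + 1) * (x + 2) * (2 * x + 3) * (2 * x + 5))) by ring.
  have x2 : 0 <= x + 2 by lra.
  have S := trm_mulS k x2.
  have -> : k.+1%:R = k%:R + 1 :> F by rewrite -[k.+1]addn1 natrD.
  transitivity ((- 260 * x ^+ 3 - 620 * x ^+ 2 - 296 * x + 96 - (576 * x ^+ 2 + 1984 * x + 1664) * (k%:R + 1)
     + (384 * x + 256) * (k%:R + 1) ^+ 2 + 1024 * (k%:R + 1) ^+ 3)
    * (18 * (2 * (x + 2) + 2 * k%:R + 3) * (k%:R + 1) * trm (x + 2) k.+1) - q k%:R * trm (x + 2) k); first by rewrite E S /q; ring.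
  by rewrite /q; ring.
rewrite /u -mulr_sumr sumrB -!mulr_sumr -/(Hsum _ _) -/(Hsum _ _) => E.
rewrite N2 -/x.
have /mulfI h : (x + 1) * (x + 2) != 0 by rewrite mulf_neq0 //; lra.
apply: h; rewrite mulr0.
have /mulfI h2 : (2 : F) != 0 by rewrite pnatr_eq0.
by apply: h2; rewrite mulr0 -[RHS]E; ring.
Qed.

End SumRecurrences.

(** * Factorial formulas for the terminating sums *)

Section ClosedForms.

Variable F : realFieldType.

Lemma natrD1 n : (n + 1)%:R = n%:R + 1 :> F.
Proof. exact: natrD. Qed.

Lemma natr_factD1 n : (n + 1)`!%:R = (n%:R + 1) * n`!%:R :> F.
Proof. by rewrite addn1 factS natrM -addn1 natrD. Qed.

Lemma fact_neq0 n : n`!%:R != 0 :> F.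
Proof. by rewrite pnatr_eq0 -lt0n fact_gt0. Qed.

Lemma Tsum_small (N K : nat) : (N < 2)%N -> (0 < K)%N -> Tsum K (N%:R : F) = 1.
Proof.
move=> N2; case: K => // K _; rewrite /Tsum big_ord_recl trm0 big1 ?addr0 // => i _.
by rewrite trm_eq0 //= /bump; lia.
Qed.

Lemma Hsum_small (N K : nat) : (N < 2)%N -> (0 < K)%N -> Hsum K (N%:R : F) = 10 * N%:R + 6.
Proof.
move=> N2; case: K => // K _; rewrite /Hsum big_ord_recl trm0 big1 ?addr0 => [|i _]; first by rewrite /= mulr0n; ring.
by rewrite trm_eq0 ?mulr0 //= /bump; lia.
Qed.

(** The recurrence moves N by 2 and the sum is 1 at N = 0 and N = 1, so each parity has its own
    product of factorials. *)
Lemma Tsum_even (s K : nat) : (s < K)%N ->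
  Tsum K ((2 * s)%N%:R : F)
  = (64 / 9) ^+ s * (4 * s + 1)`!%:R * (3 * s)`!%:R / (s`!%:R * (6 * s + 1)`!%:R).
Proof.
elim: s => [|s IH] sK.
  by rewrite !muln0 Tsum_small // !fact0 !mulr1 divr1.
have := @Tsum_rec F (2 * s) K ltac:(lia); rewrite {}IH; last by lia.
have -> : (2 * s.+1 = (2 * s).+2)%N by lia.
have -> : (4 * s.+1 + 1 = 4 * s + 1 + 1 + 1 + 1 + 1)%N by lia.
have -> : (3 * s.+1 = 3 * s + 1 + 1 + 1)%N by lia.
have -> : (6 * s.+1 + 1 = 6 * s + 1 + 1 + 1 + 1 + 1 + 1 + 1)%N by lia.
rewrite -[s.+1]addn1 exprD expr1 !natr_factD1 !natrD1 !natrM.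
move: (Tsum _ _) (fact_neq0 (6 * s)) (fact_neq0 s) (ler0n F s) => T.
move: (_ ^+ s) _`!%:R _`!%:R _`!%:R _`!%:R (s%:R : F).
move=> c b4 b3 b1 b6 x b6_0 b1_0 x0 E.
have /mulfI : 27 * (3 * (2 * x) + 5) * (3 * (2 * x) + 7) != 0.
  by rewrite !mulf_neq0 //; lra.
apply; rewrite E; field.
by rewrite b6_0 b1_0 /=; repeat (apply/andP; split); lra.
Qed.

Lemma Tsum_odd (s K : nat) : (s < K)%N ->
  Tsum K ((2 * s + 1)%N%:R : F)
  = (2 / 3) ^+ (2 * s + 1) * (4 * s + 3)`!%:R * (s + 1)`!%:R
    / ((2 * s + 2)`!%:R * (3 * s + 2)`!%:R).
Proof.
elim: s => [|s IH] sK.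
  rewrite !muln0 !add0n Tsum_small // expr1.
  have -> : (3`! = 6)%N by []. have -> : (2`! = 2)%N by []. have -> : (1`! = 1)%N by [].
  by field.
have := @Tsum_rec F (2 * s + 1) K ltac:(lia); rewrite {}IH; last by lia.
have -> : (2 * s.+1 + 1 = (2 * s + 1).+2)%N by lia.
have -> : (4 * s.+1 + 3 = 4 * s + 1 + 1 + 1 + 1 + 1 + 1 + 1)%N by lia.
have -> : (4 * s + 3 = 4 * s + 1 + 1 + 1)%N by lia.
have -> : (2 * s.+1 + 2 = 2 * s + 1 + 1 + 1 + 1)%N by lia.
have -> : (2 * s + 2 = 2 * s + 1 + 1)%N by lia.
have -> : (3 * s.+1 + 2 = 3 * s + 1 + 1 + 1 + 1 + 1)%N by lia.
have -> : (3 * s + 2 = 3 * s + 1 + 1)%N by lia.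
rewrite -[s.+1]addn1 2![_ ^+ _.+1]exprS !natr_factD1 !natrD1 !natrM.
move: (Tsum _ _) (fact_neq0 (2 * s)) (fact_neq0 (3 * s)) (ler0n F s) => T.
move: (_ ^+ (2 * s + 1)) _`!%:R _`!%:R _`!%:R _`!%:R (s%:R : F).
move=> c b4 b1 b3 b2 x b2_0 b3_0 x0 E.
have /mulfI : 27 * (3 * (2 * x + 1) + 5) * (3 * (2 * x + 1) + 7) != 0.
  by rewrite !mulf_neq0 //; lra.
apply; rewrite E; field.
by rewrite b3_0 b2_0 /=; repeat (apply/andP; split); lra.
Qed.

Lemma Hsum_even (s K : nat) : (s < K)%N ->
  Hsum K ((2 * s)%N%:R : F)
  = 6 * (4 / 9) ^+ s * (4 * s + 1)`!%:R * s`!%:R / ((2 * s)`!%:R * (3 * s)`!%:R).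
Proof.
elim: s => [|s IH] sK.
  by rewrite !muln0 Hsum_small // !fact0 !mulr1 divr1; ring.
have := @Hsum_rec F (2 * s) K ltac:(lia); rewrite {}IH; last by lia.
have -> : (4 * s.+1 + 1 = 4 * s + 1 + 1 + 1 + 1 + 1)%N by lia.
have -> : (2 * s.+1)`! = (2 * s + 1 + 1)`! by congr _`!; lia.
have -> : (2 * s.+1 = (2 * s).+2)%N by lia.
have -> : (3 * s.+1 = 3 * s + 1 + 1 + 1)%N by lia.
rewrite -[s.+1]addn1 exprD expr1 !natr_factD1 !natrD1 !natrM.
move: (Hsum _ _) (fact_neq0 (2 * s)) (fact_neq0 (3 * s)) (ler0n F s) => T.
move: (_ ^+ s) _`!%:R _`!%:R _`!%:R _`!%:R (s%:R : F).
move=> c b4 b1 b3 b2 x b2_0 b3_0 x0 E.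
have /mulfI : 27 * (3 * (2 * x) + 2) * (3 * (2 * x) + 4) != 0.
  by rewrite !mulf_neq0 //; lra.
apply; rewrite E; field.
by rewrite b3_0 b2_0 /=; repeat (apply/andP; split); lra.
Qed.

Lemma Hsum_odd (s K : nat) : (s < K)%N ->
  Hsum K ((2 * s + 1)%N%:R : F)
  = 6 * (8 / 3) ^+ (2 * s + 1) * (4 * s + 3)`!%:R * (2 * s + 2)%:R * (3 * s + 2)`!%:R
    / ((6 * s + 4)`!%:R * (s + 1)`!%:R).
Proof.
elim: s => [|s IH] sK.
  rewrite !muln0 !add0n Hsum_small // expr1.
  have -> : (4`! = 24)%N by [].
  have -> : (3`! = 6)%N by []. have -> : (2`! = 2)%N by []. have -> : (1`! = 1)%N by [].
  by field.
have := @Hsum_rec F (2 * s + 1) K ltac:(lia); rewrite {}IH; last by lia.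
have -> : (2 * s.+1 + 1 = (2 * s + 1).+2)%N by lia.
have -> : (4 * s.+1 + 3 = 4 * s + 1 + 1 + 1 + 1 + 1 + 1 + 1)%N by lia.
have -> : (4 * s + 3 = 4 * s + 1 + 1 + 1)%N by lia.
have -> : (2 * s.+1 + 2 = 2 * s + 1 + 1 + 1 + 1)%N by lia.
have -> : (2 * s + 2 = 2 * s + 1 + 1)%N by lia.
have -> : (3 * s.+1 + 2 = 3 * s + 1 + 1 + 1 + 1 + 1)%N by lia.
have -> : (3 * s + 2 = 3 * s + 1 + 1)%N by lia.
have -> : (6 * s.+1 + 4 = 6 * s + 1 + 1 + 1 + 1 + 1 + 1 + 1 + 1 + 1 + 1)%N by lia.
have -> : (6 * s + 4 = 6 * s + 1 + 1 + 1 + 1)%N by lia.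
rewrite -[s.+1]addn1 2![_ ^+ _.+1]exprS !natr_factD1 !natrD1 !natrM.
move: (Hsum _ _) (fact_neq0 (6 * s)) (fact_neq0 s) (ler0n F s) => T.
move: (_ ^+ (2 * s + 1)) _`!%:R _`!%:R _`!%:R _`!%:R (s%:R : F).
move=> c b4 b3 b6 b1 x b6_0 b1_0 x0 E.
have /mulfI : 27 * (3 * (2 * x + 1) + 2) * (3 * (2 * x + 1) + 4) != 0.
  by rewrite !mulf_neq0 //; lra.
apply; rewrite E; field.
by rewrite b6_0 b1_0 /=; repeat (apply/andP; split); lra.
Qed.

(** The parity-dependent factors cancel between the two sums. A uniform formula serves both
    interpolation points, since (p-1)/2 and (3p-1)/2 have opposite parities. *)
Lemma THsum (N K : nat) : (N < 2 * K)%N ->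
  Tsum K (N%:R : F) * Hsum K N%:R
  = 6 * (16 / 9) ^+ N * (2 * N + 1)`!%:R ^+ 2 / (N`!%:R * (3 * N + 1)`!%:R).
Proof.
move=> NK.
have [s [e|e]] : exists s, N = (2 * s)%N \/ N = (2 * s + 1)%N by exists N./2; lia.
  rewrite e Tsum_even ?Hsum_even; try lia.
  rewrite !mulnA -[(2 * 2)%N]/4%N -[(3 * 2)%N]/6%N.
  have -> : (16 / 9 : F) ^+ (2 * s) = (64 / 9) ^+ s * (4 / 9) ^+ s.
    by rewrite exprM -exprMn; congr (_ ^+ _); field.
  move: (fact_neq0 (2 * s)) (fact_neq0 (6 * s + 1)) (fact_neq0 s) (fact_neq0 (3 * s)).
  move: (_ ^+ _ : F) (_ ^+ _ : F) _`!%:R _`!%:R _`!%:R _`!%:R _`!%:R => *.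
  by field; apply/and4P; split.
rewrite e Tsum_odd ?Hsum_odd; try lia.
have -> : (2 * (2 * s + 1) + 1 = 4 * s + 3)%N by lia.
have -> : (3 * (2 * s + 1) + 1 = 6 * s + 4)%N by lia.
have -> : (16 / 9 : F) ^+ (2 * s + 1) = (2 / 3) ^+ (2 * s + 1) * (8 / 3) ^+ (2 * s + 1).
  by rewrite -exprMn; congr (_ ^+ _); field.
have -> : (2 * s + 2 = 2 * s + 1 + 1)%N by lia.
rewrite (natr_factD1 (2 * s + 1)) natrD1.
move: (fact_neq0 (2 * s + 1)) (fact_neq0 (6 * s + 4)) (fact_neq0 (s + 1)) (fact_neq0 (3 * s + 2)).
have : (2 * s + 1)%:R + 1 != 0 :> F by rewrite -natrD1 pnatr_eq0 addn1.
move: (_ ^+ _ : F) (_ ^+ _ : F) _`!%:R _`!%:R _`!%:R _`!%:R _`!%:R (_%:R + 1).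
move=> *; field.
have : 0 <= s%:R :> F by rewrite ler0n.
by clear e; move=> ?; repeat (apply/andP; split) => //; lra.
Qed.

End ClosedForms.

(** * Reduction modulo p^2 *)

Section Reduction.

Variable p : nat.
Hypothesis p_pr : prime p.
Notation R := 'Z_(p ^ 2)%N.

Lemma p2_gt1 : (1 < p ^ 2)%N.
Proof. by rewrite -(exp1n 2) ltn_exp2r // prime_gt1. Qed.

Lemma natR_eq0 (a : nat) : (a%:R == 0 :> R) = (p ^ 2 %| a)%N.
Proof. by rewrite -val_eqE /= val_Zp_nat ?p2_gt1. Qed.

Lemma intR_eq0 (a : int) : (a%:~R == 0 :> R) = (p ^ 2 %| `|a|)%N.
Proof.
by case: (intP a) => [|n|n]; rewrite ?rmorphN /= ?oppr_eq0 ?abszN natR_eq0.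
Qed.

Lemma unitR_nat (a : nat) : ((a%:R : R) \is a GRing.unit) = coprime p a.
Proof. by rewrite unitZpE ?p2_gt1 // coprime_pexpl. Qed.

Lemma unitR_int (a : int) : ((a%:~R : R) \is a GRing.unit) = coprime p `|a|.
Proof.
by case: (intP a) => [|n|n]; rewrite ?rmorphN /= ?unitrN ?abszN unitR_nat.
Qed.

Lemma natR_val (x : R) : x = (val x)%:R.
Proof. by rewrite natr_Zp. Qed.

Lemma pp0 : p%:R * p%:R = 0 :> R.
Proof. by apply/eqP; rewrite -natrM mulnn natR_eq0. Qed.

Lemma nonunitR (x : R) : x \isn't a GRing.unit -> exists z, x = p%:R * z.
Proof.
rewrite [x]natR_val unitR_nat prime_coprime // negbK => /dvdnP [k ->].
by exists k%:R; rewrite natrM mulrC.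
Qed.

Lemma pmulR_nonunit (z : R) : p%:R * z \isn't a GRing.unit.
Proof. by rewrite unitrM unitR_nat prime_coprime // dvdnn. Qed.

(** Z/p^2 is a local ring: its nonunits form the ideal generated by p. *)
Lemma unitR_add (x y : R) : x + y \is a GRing.unit ->
  (x \is a GRing.unit) || (y \is a GRing.unit).
Proof.
apply: contraTT; rewrite negb_or => /andP [/nonunitR [a ->] /nonunitR [b ->]].
by rewrite -mulrDr pmulR_nonunit.
Qed.

Lemma unitR_addp (x z : R) : x \is a GRing.unit -> x + p%:R * z \is a GRing.unit.
Proof.
move=> ux; have := @unitR_add (x + p%:R * z) (- (p%:R * z)).
by rewrite addrK => /(_ ux); rewrite unitrN (negbTE (pmulR_nonunit z)) orbF.
Qed.

(* [reduces x r]: the rational [x] has a denominator prime to [p], and [r] is its image in Z/p^2. *)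
Definition reduces (x : rat) (r : R) : Prop :=
  exists a d, [/\ coprime p d, x = a%:~R / d%:R & r = a%:~R / d%:R].

Lemma coprime_neq0 (d : nat) : coprime p d -> d%:R != 0 :> rat.
Proof.
rewrite pnatr_eq0 prime_coprime //; apply: contraNneq => ->; exact: dvdn0.
Qed.

Lemma reduces_int (a : int) : reduces a%:~R a%:~R.
Proof. by exists a, 1%N; split; rewrite ?coprimen1 // ?divr1. Qed.

Lemma reduces_nat (a : nat) : reduces a%:R a%:R.
Proof. exact: reduces_int a. Qed.

Lemma reduces0 : reduces 0 0. Proof. exact: reduces_nat 0. Qed.

Lemma reduces1 : reduces 1 1. Proof. exact: reduces_nat 1. Qed.

Lemma reducesD x r y s : reduces x r -> reduces y s -> reduces (x + y) (r + s).
Proof.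
move=> [a [d [cd -> ->]]] [b [e [ce -> ->]]].
exists (a * e%:Z + b * d%:Z), (d * e)%N; split; first by rewrite coprimeMr cd.
  by rewrite natrM addf_div ?coprime_neq0 // rmorphD !rmorphM.
have ud : (d%:R : R) \is a GRing.unit by rewrite unitR_nat.
have ue : (e%:R : R) \is a GRing.unit by rewrite unitR_nat.
rewrite natrM invrM // rmorphD !rmorphM /= !mulrDl.
have -> : a%:~R * e%:R * (e%:R^-1 / d%:R) = a%:~R / d%:R * (e%:R / e%:R) :> R by ring.
have -> : b%:~R * d%:R * (e%:R^-1 / d%:R) = b%:~R / e%:R * (d%:R / d%:R) :> R by ring.
by rewrite !divrr // !mulr1.
Qed.

Lemma reducesM x r y s : reduces x r -> reduces y s -> reduces (x * y) (r * s).
Proof.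
move=> [a [d [cd -> ->]]] [b [e [ce -> ->]]].
exists (a * b), (d * e)%N; split; first by rewrite coprimeMr cd.
  by rewrite natrM mulf_div rmorphM.
by rewrite natrM invrM ?unitR_nat // rmorphM /=; ring.
Qed.

Lemma reducesN x r : reduces x r -> reduces (- x) (- r).
Proof.
move=> [a [d [cd -> ->]]]; exists (- a), d.
by split; rewrite // rmorphN mulNr.
Qed.

Lemma reducesB x r y s : reduces x r -> reduces y s -> reduces (x - y) (r - s).
Proof. by move=> h1 h2; apply: reducesD => //; apply: reducesN. Qed.

Lemma reducesV x r : r \is a GRing.unit -> reduces x r -> reduces x^-1 r^-1.
Proof.
move=> ur [a [d [cd ex er]]]; rewrite {}ex {}er in ur *.
have ud : (d%:R : R) \is a GRing.unit by rewrite unitR_nat.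
move: ur; rewrite unitrM unitrV ud andbT => ua.
(* Witness denominators are natural numbers, so a negative numerator is treated through its
   opposite. *)
have pos (n : nat) : (n%:R : R) \is a GRing.unit ->
    reduces (n%:R / d%:R)^-1 (n%:R / d%:R)^-1.
  move=> un; exists d%:Z, n; split; first by rewrite -unitR_nat.
    by rewrite invf_div.
  by rewrite invrM ?unitrV // invrK.
case: (intP a) ua => [|n|n]; [exact: (pos 0%N) | exact: (pos n.+1) |].
rewrite !rmorphN /= unitrN !mulNr !invrN => un.
by apply: reducesN; apply: pos.
Qed.

Lemma reduces_div x r y s : s \is a GRing.unit ->
  reduces x r -> reduces y s -> reduces (x / y) (r / s).
Proof. by move=> us h1 h2; apply: reducesM => //; apply: reducesV. Qed.

Lemma reducesX x r n : reduces x r -> reduces (x ^+ n) (r ^+ n).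
Proof.
move=> h; elim: n => [|n IH]; first exact: reduces1.
by rewrite !exprS; apply: reducesM.
Qed.

Lemma reduces_sum (I : Type) (l : seq I) (P : pred I) (F : I -> rat) (G : I -> R) :
  (forall i, P i -> reduces (F i) (G i)) ->
  reduces (\sum_(i <- l | P i) F i) (\sum_(i <- l | P i) G i).
Proof. by move=> h; apply: (big_rec2 reduces) => [|i x r Pi]; [exact: reduces0|apply: reducesD; apply: h]. Qed.

Lemma reduces_prod (I : Type) (l : seq I) (P : pred I) (F : I -> rat) (G : I -> R) :
  (forall i, P i -> reduces (F i) (G i)) ->
  reduces (\prod_(i <- l | P i) F i) (\prod_(i <- l | P i) G i).
Proof. by move=> h; apply: (big_rec2 reduces) => [|i x r Pi]; [exact: reduces1|apply: reducesM; apply: h]. Qed.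

(** Identities pass from the rationals to R by reducing one number in two ways. *)
Lemma reduces_eq x r s : reduces x r -> reduces x s -> r = s.
Proof.
move=> [a [d [cd -> ->]]] [b [e [ce h ->]]].
have ud : (d%:R : R) \is a GRing.unit by rewrite unitR_nat.
have ue : (e%:R : R) \is a GRing.unit by rewrite unitR_nat.
apply: (mulIr ud); rewrite mulrVK //; apply: (mulIr ue).
rewrite mulrAC mulrVK // -[d%:R]/(d%:Z%:~R) -[e%:R]/(e%:Z%:~R) -!intrM.
congr _%:~R.
apply: (@intr_inj rat); rewrite !intrM.
by move/eqP: h; rewrite eqr_div ?coprime_neq0 // => /eqP.
Qed.

Lemma reduces_congr x y r : reduces x r -> reduces y r -> rat_congr p 2 x y.
Proof.
move=> hx hy; have := reducesB hx hy; rewrite subrr => -[a [d [cd h h0]]].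
have ud : (d%:R : R) \is a GRing.unit by rewrite unitR_nat.
have : (a%:~R == 0 :> R).
  by rewrite -(mulrVK ud a%:~R) -h0 mul0r.
rewrite intR_eq0 => /dvdnP [k ak].
exists ((sgz a * k%:Z)%:~R / d%:R); rewrite h; split.
  rewrite {1}[a]intEsg ak rmorphM /= rmorphM /= [RHS]mulrA; congr (_ / _).
  by rewrite -[(_ * _)%:~R]/((k * p ^ 2)%N%:R : rat) natrM; ring.
have d0 : d%:Z != 0 by rewrite -(eqr_int rat) coprime_neq0.
have {}cd : coprime p `|d%:Z| by [].
rewrite -[d%:R]/(d%:Z%:~R) coprime_sym; move: (sgz a * k%:Z) d0 cd => b.
(* The reduced denominator divides d and so inherits coprimality to p. *)
case: divqP => [_|c x' _ _] //.
by rewrite abszM coprimeMr => /andP [].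
Qed.

End Reduction.

(** * Factorials and harmonic numbers modulo p^2 *)

(** The block (q + 1) ... (q + k), to be taken at multiples q of p; the factorials of the closed
    forms are cut into such blocks. *)
Definition rising (K : pzRingType) (q : K) (k : nat) : K := \prod_(i < k) (q + i.+1%:R).

Lemma prod_ord_split (K : comPzRingType) (f : nat -> K) a b :
  \prod_(i < a + b) f i = \prod_(i < a) f i * \prod_(i < b) f (a + i)%N.
Proof. by rewrite big_split_ord. Qed.

Lemma prod_ord_rev (K : comPzRingType) (f : nat -> K) k :
  \prod_(i < k) f i = \prod_(i < k) f (k - i.+1)%N.
Proof. by rewrite (reindex_inj rev_ord_inj). Qed.

Lemma prod_opp (K : comPzRingType) (f : nat -> K) k :
  \prod_(i < k) - f i = (-1) ^+ k * \prod_(i < k) f i.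
Proof.
by rewrite prodrN card_ord.
Qed.

Lemma rising_fact (K : comPzRingType) (a k : nat) :
  (a + k)`!%:R = a`!%:R * rising (a%:R : K) k.
Proof.
elim: k => [|k IH]; first by rewrite /rising big_ord0 addn0 mulr1.
rewrite /rising big_ord_recr /= -/(rising _ _) mulrA -IH addnS factS natrM mulrC.
by rewrite -natrD addnS.
Qed.

Lemma rising_falling (K : comPzRingType) (a k : nat) : (k <= a)%N ->
  a`!%:R = (a - k)`!%:R * ((-1) ^+ k * rising (- a.+1%:R : K) k).
Proof.
elim: k => [|k IH] ka; first by rewrite /rising big_ord0 subn0 !mulr1.
rewrite IH; last by lia.
rewrite /rising big_ord_recr /= -/(rising _ _).
have -> : (a - k = (a - k.+1).+1)%N by lia.
have -> : - a.+1%:R + k.+1%:R = - (a - k.+1).+1%:R :> K.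
  have -> : (a.+1 = k.+1 + (a - k.+1).+1)%N by lia.
  by rewrite natrD; ring.
by rewrite factS natrM exprS; ring.
Qed.

(** The upper half is reflected. With 2n + 1 = p its base point becomes -(q + p), so that only
    blocks of length n at multiples of p remain. *)
Lemma rising_split (K : comPzRingType) (q : K) (n : nat) :
  rising q (2 * n) = rising q n * ((-1) ^+ n * rising (- (q + (2 * n + 1)%N%:R)) n).
Proof.
rewrite /rising mul2n -addnn (prod_ord_split (fun i => q + i.+1%:R)); congr (_ * _).
apply: etrans (prod_opp (fun i => - (q + (n + n + 1)%N%:R) + i.+1%:R) n).
rewrite (prod_ord_rev (fun i => q + (n + i).+1%:R)).
apply: eq_bigr => i _; have := ltn_ord i; move: (val i) => j jn.
have -> : ((n + n + 1) = (n + (n - j.+1)).+1 + j.+1)%N by lia.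
by rewrite natrD; ring.
Qed.

Lemma fact_even_odd (N : nat) :
  (N`! = 2 ^ N./2 * (N./2)`! * \prod_(i < uphalf N) (2 * i + 1))%N.
Proof.
elim/ltn_ind: N => -[|[|N]] IH //=; first by rewrite big_ord0.
  by rewrite big_ord_recl big_ord0.
rewrite factS factS (IH N) //= big_ord_recr /= expnS factS.
have : (2 * N./2.+1 * (2 * uphalf N + 1) = N.+2 * N.+1)%N.
  have := odd_double_half N; rewrite uphalf_half -mul2n; case: odd => /= h; lia.
move: (\prod_(i < _) _)%N (2 ^ _)%N => x y h.
by rewrite mulnA -h; ring.
Qed.

Section Evaluation.

Variable p : nat.
Hypothesis p_pr : prime p.
Hypothesis p_gt3 : (3 < p)%N.
Notation R := 'Z_(p ^ 2)%N.
Notation unit := GRing.unit.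

Notation n := (p./2).
Notation M := (p./2./2).

Lemma pE : p = (2 * n + 1)%N.
Proof.
have [|] := even_prime p_pr; first by lia.
by lia.
Qed.

Lemma unitR_small (a : nat) : (0 < a < p)%N -> (a%:R : R) \is a unit.
Proof. by move=> h; rewrite unitR_nat // prime_coprime // gtnNdvd; lia. Qed.

Lemma unitR_fact (k : nat) : (k < p)%N -> (k`!%:R : R) \is a unit.
Proof.
elim: k => [|k IH] kp; first by rewrite fact0 unitr1.
by rewrite factS natrM unitrM unitR_small ?IH; lia.
Qed.

Lemma unitR2 : (2 : R) \is a unit. Proof. by apply: (@unitR_small 2); lia. Qed.
Lemma unitR3 : (3 : R) \is a unit. Proof. by apply: (@unitR_small 3); lia. Qed.

(* As p^2 = 0 in [R], [ep] turns addition into multiplication. *)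
Definition ep (x : R) : R := 1 + p%:R * x.

Lemma epM x y : ep x * ep y = ep (x + y).
Proof.
rewrite /ep; have -> : (1 + p%:R * x) * (1 + p%:R * y) = 1 + p%:R * (x + y) + p%:R * p%:R * (x * y) by ring.
by rewrite pp0 // mul0r addr0.
Qed.

Lemma ep0 : ep 0 = 1. Proof. by rewrite /ep mulr0 addr0. Qed.

Lemma ep_unit x : ep x \is a unit.
Proof. by apply/unitrPr; exists (ep (- x)); rewrite epM subrr ep0. Qed.

Lemma epV x : (ep x)^-1 = ep (- x).
Proof. by apply: (mulIr (ep_unit x)); rewrite mulVr ?ep_unit // epM addNr ep0. Qed.

Lemma epX x k : ep x ^+ k = ep (x *+ k).
Proof. by elim: k => [|k IH]; rewrite ?expr0 ?mulr0n ?ep0 // exprS IH epM mulrS. Qed.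

Lemma p_ep x : p%:R * ep x = p%:R.
Proof. by rewrite /ep mulrDr mulr1 mulrA pp0 // mul0r addr0. Qed.

Definition harm (k : nat) : R := \sum_(i < k) i.+1%:R^-1.

Lemma harmS k : harm k.+1 = harm k + k.+1%:R^-1.
Proof. by rewrite /harm big_ord_recr. Qed.

(** Each factor is c p + j = j (1 + p c/j), and the corrections add up because p^2 = 0. *)
Lemma rising_ep (c : R) (k : nat) : (k < p)%N ->
  rising (c * p%:R) k = k`!%:R * ep (c * harm k).
Proof.
elim: k => [|k IH] kp; first by rewrite /rising /harm !big_ord0 mulr0 ep0 mulr1.
rewrite /rising big_ord_recr /= -/(rising _ _) IH; last by lia.
rewrite [harm k.+1]harmS factS natrM [c * (_ + _)]mulrDr -epM.
have u : (k.+1%:R : R) \is a unit by apply: unitR_small; lia.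
have -> : c * p%:R + k.+1%:R = k.+1%:R * ep (c / k.+1%:R).
  rewrite /ep mulrDr mulr1 addrC; congr (_ + _).
  have -> : k.+1%:R * (p%:R * (c / k.+1%:R)) = k.+1%:R / k.+1%:R * (c * p%:R) by ring.
  by rewrite divrr // mul1r.
ring.
Qed.

Notation A := (harm n).
Notation B := (harm M).

Lemma n_small : (n < p)%N. Proof. by have := pE; lia. Qed.
Lemma M_small : (M < p)%N. Proof. by have := pE; lia. Qed.

(* p - 2i runs through odd numbers, which will be compared with the factorials. *)
Lemma half_oddprod (k : nat) :
  \prod_(i < k) (p%:R - 2 * i.+1%:R) = (-2) ^+ k * rising (- 2^-1 * p%:R : R) k.
Proof.
rewrite /rising; elim: k => [|k IH]; first by rewrite !big_ord0 mulr1.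
rewrite !big_ord_recr /= {}IH exprS.
have -> : p%:R - 2 * k.+1%:R = (-2) * (- 2^-1 * p%:R + k.+1%:R) + (1 - 2 / 2) * p%:R :> R by ring.
by rewrite divrr ?unitR2 // subrr mul0r addr0; ring.
Qed.

(* Split (p-1)! into even and odd factors in two ways; this is H_n = -2 q_p(2) mod p. *)
Lemma pow4_harm : (2 : R) ^+ n * 2 ^+ n = ep (- A / 2).
Proof.
have uf := unitR_fact n_small.
have e1 : (2 * n)`!%:R = n`!%:R * ((-1) ^+ n * (n`!%:R * ep (- A))) :> R.
  rewrite (@rising_falling _ (2 * n) n); last by lia.
  have -> : (2 * n - n = n)%N by lia.
  have -> : ((2 * n).+1 = p)%N by have := pE; lia.
  by rewrite -[- p%:R]mulN1r rising_ep ?n_small // mulN1r.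
have e2 : (2 * n)`!%:R = 2 ^+ n * n`!%:R * ((-2) ^+ n * (n`!%:R * ep (- 2^-1 * A))) :> R.
  rewrite fact_even_odd mul2n doubleK uphalf_double !natrM natrX; congr (_ * _).
  rewrite -rising_ep ?n_small // -half_oddprod.
  rewrite (prod_ord_rev (fun i => p%:R - 2 * i.+1%:R)) natr_prod.
  apply: eq_bigr => i _; have := ltn_ord i; move: (val i) => j jn.
  apply/eqP; rewrite eq_sym subr_eq -natrM -natrD; apply/eqP; congr _%:R.
  by have := pE; move: (n) jn => n0; lia.
have us : ((-1) ^+ n : R) \is a unit by rewrite unitrX // unitrN unitr1.
apply: (mulIr uf); apply: (mulIr uf); apply: (mulIr us).
apply: (mulIr (ep_unit (- 2^-1 * A))).
have -> : 2 ^+ n * 2 ^+ n * n`!%:R * n`!%:R * (-1) ^+ n * ep (- 2^-1 * A) = (2 * n)`!%:R :> R.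
  by rewrite e2 -[- (2)]mulN1r exprMn; ring.
have -> : - A / 2 = - 2^-1 * A :> R by ring.
rewrite e1 [LHS]mulrCA.
have -> : ep (- 2^-1 * A) * n`!%:R * n`!%:R * (-1) ^+ n * ep (- 2^-1 * A) =
  n`!%:R * n`!%:R * (-1) ^+ n * (ep (- 2^-1 * A) * ep (- 2^-1 * A)) :> R by ring.
rewrite epM.
have -> : - 2^-1 * A + - 2^-1 * A = - (2 / 2) * A :> R by ring.
by rewrite divrr ?unitR2 // mulN1r; ring.
Qed.

(* The same splitting for n!; this is H_[p/4] = -3 q_p(2) mod p. *)
Lemma harm_quarter : ep (- B) = ep (- A - A / 2).
Proof.
have uf := unitR_fact n_small; have um := unitR_fact M_small.
pose O : R := \prod_(i < uphalf n) (2 * i + 1)%N%:R.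
have e1 : n`!%:R = 2 ^+ M * M`!%:R * O :> R.
  by rewrite fact_even_odd !natrM natrX natr_prod.
have nM : n = (M + uphalf n)%N by rewrite uphalf_half; lia.
have e2 : (-2) ^+ n * (n`!%:R * ep (- 2^-1 * A)) = (-2) ^+ M * (M`!%:R * ep (- 2^-1 * B)) * O.
  rewrite -!rising_ep ?n_small ?M_small // -!half_oddprod.
  have -> : \prod_(i < n) (p%:R - 2 * i.+1%:R) = \prod_(i < M + uphalf n) (p%:R - 2 * i.+1%:R) :> R.
    by rewrite -nM.
  rewrite (prod_ord_split (fun i => p%:R - 2 * i.+1%:R)); congr (_ * _).
  rewrite (prod_ord_rev (fun i => p%:R - 2 * (M + i).+1%:R)).
  apply: eq_bigr => i _; have := ltn_ord i; move: (val i) => j jn.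
  apply/eqP; rewrite subr_eq -natrM -natrD; apply/eqP; congr _%:R.
  by have := pE; move: (n) jn => n0; lia.
have e3 : 2 ^+ n * ep (- 2^-1 * A) * (-1) ^+ n = (-1) ^+ M * ep (- 2^-1 * B) :> R.
  apply: (mulIr uf).
  have -> : 2 ^+ n * ep (- 2^-1 * A) * (-1) ^+ n * n`!%:R = (-2) ^+ n * (n`!%:R * ep (- 2^-1 * A)) :> R.
    by rewrite -[- (2)]mulN1r exprMn; ring.
  by rewrite e2 e1 -[- (2)]mulN1r exprMn; ring.
have sq (k : nat) : (-1) ^+ k * (-1) ^+ k = 1 :> R by rewrite -exprMn mulrNN mulr1 expr1n.
have half x : ep (- 2^-1 * x) * ep (- 2^-1 * x) = ep (- x).
  rewrite epM; congr ep.
  have -> : - 2^-1 * x + - 2^-1 * x = - (2 / 2) * x :> R by ring.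
  by rewrite divrr ?unitR2 // mulN1r.
transitivity (((-1) ^+ M * ep (- 2^-1 * B)) * ((-1) ^+ M * ep (- 2^-1 * B))).
  by rewrite mulrACA sq mul1r half.
rewrite -e3.
have -> : 2 ^+ n * ep (- 2^-1 * A) * (-1) ^+ n * (2 ^+ n * ep (- 2^-1 * A) * (-1) ^+ n) =
  (2 ^+ n * 2 ^+ n) * (ep (- 2^-1 * A) * ep (- 2^-1 * A)) * ((-1) ^+ n * (-1) ^+ n) :> R by ring.
by rewrite sq mulr1 half pow4_harm epM mulNr addrC.
Qed.

End Evaluation.

(** * The closed forms at the two interpolation points modulo p^2 *)

Section ClosedFormReduction.

Variable p : nat.
Hypothesis p_pr : prime p.
Hypothesis p_gt3 : (3 < p)%N.
Notation R := 'Z_(p ^ 2)%N.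
Notation unit := GRing.unit.
Notation n := (p./2).
Notation M := (p./2./2).
Notation A := (harm p n).
Notation B := (harm p M).

Lemma reduces_rising x (y : R) (k : nat) : (k < p)%N -> reduces x y ->
  reduces (rising (x * p%:R) k) (k`!%:R * ep (y * harm p k)).
Proof.
move=> kp xy; rewrite -rising_ep //; apply: reduces_prod => // i _.
apply: reducesD => //; last exact: reduces_nat.
by apply: reducesM => //; exact: reduces_nat.
Qed.

Lemma fact_mulS (c : nat) :
  (c.+1 * p)`!%:R = (c * p)`!%:R * rising (c%:R * p%:R) (2 * n) * (c.+1%:R * p%:R) :> rat.
Proof.
have -> : (c.+1 * p = (c * p + 2 * n).+1)%N by have := pE p_pr p_gt3; lia.
rewrite factS natrM rising_fact natrM mulrC; congr (_ * _).
by rewrite -natrM; congr _%:R; have := pE p_pr p_gt3; lia.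
Qed.

Lemma fact_mulD (c k : nat) :
  (c * p + k)`!%:R = (c * p)`!%:R * rising (c%:R * p%:R : rat) k.
Proof. by rewrite rising_fact natrM. Qed.

Lemma fact_predB (k : nat) : (k <= p.-1)%N ->
  p.-1`!%:R = (p.-1 - k)`!%:R * ((-1) ^+ k * rising (- 1 * p%:R : rat) k).
Proof.
move=> kp; rewrite (rising_falling _ kp) mulN1r; congr (_ * (_ * rising (- _%:R) _)); lia.
Qed.

Lemma rising_double (c : nat) :
  rising (c%:R * p%:R : rat) (2 * n)
  = rising (c%:R * p%:R) n * ((-1) ^+ n * rising (- c.+1%:R * p%:R) n).
Proof.
rewrite rising_split; congr (_ * (_ * rising _ _)).
by rewrite -(pE p_pr p_gt3) -[c.+1]addn1 natrD; ring.
Qed.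

(** The image modulo p^2 is a unit, hence the rational number is not 0. *)
Lemma rising_neq0 (c : int) (k : nat) : (k < p)%N -> rising (c%:~R * p%:R : rat) k != 0.
Proof.
move=> kp; apply/negP => /eqP h.
have := reduces_rising kp (reduces_int p c); rewrite h => /(reduces_eq p_pr (reduces0 p)) /esym e.
have : (k`!%:R * ep (c%:~R * harm p k) : R) \is a unit.
  by rewrite unitrM unitR_fact ?ep_unit.
by rewrite e unitr0.
Qed.

(* [closed1] and [closed2] are the values of [Tsum] at N = n and N = n + p when p = 1 mod 4; when
   p = 3 mod 4 those of [Hsum] are 12 times as large. *)
Definition closed1 : rat := (8 / 3) ^+ n * p`!%:R * (p.-1 - M)`!%:R / (M`!%:R * (p + n)`!%:R).

Definition closed2 : rat :=
  2^-1 * (2 / 3) ^+ (3 * n + 1) * (3 * p)`!%:R * (p.-1 - M)`!%:R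
  / ((p + n)`!%:R * (2 * p + M)`!%:R).

Lemma n_le : (n <= p.-1)%N. Proof. by have := n_small p_pr p_gt3; lia. Qed.
Lemma M_le : (M <= p.-1)%N. Proof. by have := M_small p_pr p_gt3; lia. Qed.

Lemma signrr (K : pzRingType) k : (-1) ^+ k * (-1) ^+ k = 1 :> K.
Proof. by rewrite -expr2 sqrr_sign. Qed.

Lemma p_neq0 : p%:R != 0 :> rat.
Proof. by rewrite pnatr_eq0; lia. Qed.

Lemma pfactE : p`!%:R = p%:R * p.-1`!%:R :> rat.
Proof. by rewrite -natrM; congr _%:R; case: (p) p_gt3. Qed.

(** Here and in [closed2E] the powers of p in the factorials cancel, which leaves a numerator and a
    denominator that can be reduced separately. *)
Lemma closed1E : closed1 = (8 / 3) ^+ n * (n`!%:R * ((-1) ^+ n * rising (-1 * p%:R) n))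
  / ((-1) ^+ M * rising (-1 * p%:R) M * M`!%:R * rising (1 * p%:R) n).
Proof.
rewrite /closed1.
have -> : (p + n = 1 * p + n)%N by lia.
rewrite fact_mulD mul1n.
have h1 := fact_predB n_le; have h2 := fact_predB M_le.
have e : (p.-1 - n = n)%N by have := pE p_pr p_gt3; lia.
rewrite e in h1; rewrite -h1 h2.
have := @rising_neq0 (-1) _ (M_small p_pr p_gt3); rewrite rmorphN1.
have := @rising_neq0 1 _ (n_small p_pr p_gt3); rewrite rmorph1.
move: (fact_neq0 rat M) (fact_neq0 rat p) (signr_eq0 rat M).
move: ((-1) ^+ M : rat) ((8 / 3) ^+ n : rat) => a b ? ? /negbT ? ? ?.
by field; repeat (apply/andP; split).
Qed.

Lemma closed2E : closed2 = (2 / 3) ^+ (3 * n)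
  * (rising (2 * p%:R) n * ((-1) ^+ n * rising (- 3 * p%:R) n))
  / (rising (1 * p%:R) n * rising (2 * p%:R) M * ((-1) ^+ M * rising (-1 * p%:R) M)).
Proof.
rewrite /closed2.
have -> : (p + n = 1 * p + n)%N by lia.
rewrite !fact_mulD fact_mulS !mul1n rising_double exprD expr1 pfactE.
rewrite (fact_predB M_le).
have := @rising_neq0 (-1) _ (M_small p_pr p_gt3); rewrite rmorphN1.
have := @rising_neq0 1 _ (n_small p_pr p_gt3); rewrite rmorph1.
have := @rising_neq0 2 _ (M_small p_pr p_gt3); rewrite -[2%:~R]/(2 : rat).
move: p_neq0 (fact_neq0 rat (2 * p)) (fact_neq0 rat (p.-1 - M)) (signr_eq0 rat M).
move: ((-1) ^+ M : rat) ((-1) ^+ n : rat) ((2 / 3) ^+ (3 * n) : rat) => a b c ? ? ? /negbT ? ? ? ?.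
field; repeat (apply/andP; split) => //.
Qed.

Lemma unit_sign (K : unitRingType) k : ((-1) ^+ k : K) \is a unit.
Proof. by rewrite unitrX // unitrN unitr1. Qed.

Lemma reduces_sign k : reduces ((-1) ^+ k) ((-1) ^+ k : R).
Proof. by apply: reducesX => //; exact: (reducesN (reduces1 p)). Qed.

Lemma reduces_powdiv (a b k : nat) : coprime p b ->
  reduces ((a%:R / b%:R) ^+ k) ((a%:R / b%:R) ^+ k : R).
Proof.
move=> cb; apply: reducesX => //; apply: reduces_div => //; try exact: reduces_nat.
by rewrite unitR_nat.
Qed.

Lemma coprime_p3 : coprime p 3.
Proof. by rewrite -unitR_nat //; exact: unitR3. Qed.

Definition value1 : R := (8 / 3) ^+ n * (n`!%:R * ((-1) ^+ n * (n`!%:R * ep (-1 * A))))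
  / ((-1) ^+ M * (M`!%:R * ep (-1 * B)) * M`!%:R * (n`!%:R * ep (1 * A))).

Definition value2 : R := (2 / 3) ^+ (3 * n)
  * (n`!%:R * ep (2 * A) * ((-1) ^+ n * (n`!%:R * ep (- 3 * A))))
  / (n`!%:R * ep (1 * A) * (M`!%:R * ep (2 * B)) * ((-1) ^+ M * (M`!%:R * ep (-1 * B)))).

Lemma reduces_closed1 : reduces closed1 value1.
Proof.
have np := n_small p_pr p_gt3; have Mp := M_small p_pr p_gt3.
have r1 : reduces 1 (1 : R) by exact: reduces1.
have rm1 : reduces (-1) (-1 : R) by apply: reducesN.
rewrite closed1E; apply: reduces_div => //.
- by rewrite !unitrM unit_sign !unitR_fact // !ep_unit.
- apply: reducesM => //; first by apply: reduces_powdiv coprime_p3.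
  apply: reducesM => //; first exact: reduces_nat.
  by apply: reducesM => //; [exact: reduces_sign | apply: reduces_rising].
- apply: reducesM => //; last exact: reduces_rising.
  apply: reducesM => //; last exact: reduces_nat.
  by apply: reducesM => //; [exact: reduces_sign | apply: reduces_rising].
Qed.

Lemma reduces_closed2 : reduces closed2 value2.
Proof.
have np := n_small p_pr p_gt3; have Mp := M_small p_pr p_gt3.
have r1 : reduces 1 (1 : R) by exact: reduces1.
have r2 : reduces 2 (2 : R) by exact: (reduces_nat p 2).
have rm1 : reduces (-1) (-1 : R) by apply: reducesN.
have rm3 : reduces (-3) (-3 : R) by apply: reducesN => //; exact: (reduces_nat p 3).
rewrite closed2E; apply: reduces_div => //.
- by rewrite !unitrM unit_sign !unitR_fact // !ep_unit.
- apply: reducesM => //; first by apply: reduces_powdiv coprime_p3.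
  apply: reducesM => //; first exact: reduces_rising.
  by apply: reducesM => //; [exact: reduces_sign | apply: reduces_rising].
- apply: reducesM => //; first by apply: reducesM => //; apply: reduces_rising.
  by apply: reducesM => //; [exact: reduces_sign | apply: reduces_rising].
Qed.

Lemma fermat_ep (a : nat) : coprime p a -> exists z, (a%:R : R) ^+ n * a%:R ^+ n = ep z.
Proof.
move=> ca; have := @Euler_exp_totient a p; rewrite coprime_sym => /(_ ca).
rewrite totient_prime // [in (1 %% p)%N]modn_small; last by lia.
have -> : (p.-1 = n + n)%N by have := pE p_pr p_gt3; lia.
move=> e; exists ((a ^ (n + n)) %/ p)%:R.
by rewrite -exprD -natrX {1}(divn_eq (a ^ (n + n)) p) e natrD natrM addrC mulrC.
Qed.

(** Half of H_n: then 2^(p-1) is [ep (- h)], and H_[p/4] counts as 3 h inside [ep]. All exponents of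
    2 and all harmonic numbers become integer multiples of h, which [ring] can compare. *)
Let h : R := A / 2.

Lemma Ah : A = h + h.
Proof.
rewrite /h -mulrDr; have -> : 2^-1 + 2^-1 = 2 / 2 :> R by ring.
by rewrite divrr ?mulr1 //; exact: unitR2.
Qed.

Lemma pow4_h : (2 : R) ^+ n * 2 ^+ n = ep (- h).
Proof. by rewrite pow4_harm // mulNr. Qed.

Lemma epB : ep (- B) = ep (- h *+ 3).
Proof. by rewrite harm_quarter // -/h Ah; congr ep; ring. Qed.

Lemma inv_eq (x y z : R) : y \is a unit -> x = z * y -> x / y = z.
Proof. by move=> uy ->; rewrite mulrK. Qed.

(** This is C(n, M) for p = 1 mod 4 and (M + 1) C(n, M) for p = 3 mod 4, in one expression for both
    classes. *)
Definition Dfac : R := n`!%:R / (M`!%:R * M`!%:R).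

Lemma value1E : value1 = (-1) ^+ n * (-1) ^+ M * (8 / 3) ^+ n * Dfac * ep (- h).
Proof.
have un := unitR_fact p_pr p_gt3 (n_small p_pr p_gt3).
have uM := unitR_fact p_pr p_gt3 (M_small p_pr p_gt3).
apply: inv_eq; first by rewrite !unitrM unit_sign un uM !ep_unit.
have -> : (-1 * B) = - B by rewrite mulN1r.
rewrite epB.
have -> : (n`!%:R : R) = Dfac * (M`!%:R * M`!%:R) by rewrite /Dfac mulrVK // unitrM uM.
move: (M`!%:R : R) => m.
transitivity ((8 / 3) ^+ n * (-1) ^+ n * Dfac * m * m * Dfac * m * m * ep (-1 * A)); first by ring.
transitivity (((-1) ^+ M * (-1) ^+ M) * (8 / 3) ^+ n * (-1) ^+ n * Dfac * m * m * Dfac * m * m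
   * (ep (- h) * ep (- h *+ 3) * ep (1 * A))); last by ring.
rewrite signrr !mul1r !epM //; congr (_ * ep _); rewrite Ah; ring.
Qed.

Lemma value2E : value2 = (-1) ^+ n * (-1) ^+ M * (2 / 3) ^+ (3 * n) * Dfac * ep (- h *+ 7).
Proof.
have un := unitR_fact p_pr p_gt3 (n_small p_pr p_gt3).
have uM := unitR_fact p_pr p_gt3 (M_small p_pr p_gt3).
apply: inv_eq; first by rewrite !unitrM unit_sign un uM !ep_unit.
have e2B : ep (2 * B) = ep (h *+ 6).
  have -> : 2 * B = - (- B + - B) :> R by ring.
  rewrite -epV // -epM // epB epM // epV //; congr ep; ring.
have -> : (-1 * B) = - B by rewrite mulN1r.
rewrite epB e2B.
have -> : (n`!%:R : R) = Dfac * (M`!%:R * M`!%:R) by rewrite /Dfac mulrVK // unitrM uM.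
move: (M`!%:R : R) => m.
transitivity ((2 / 3) ^+ (3 * n) * (-1) ^+ n * Dfac * m * m * Dfac * m * m * (ep (2 * A) * ep (- 3 * A))); first by ring.
transitivity (((-1) ^+ M * (-1) ^+ M) * (2 / 3) ^+ (3 * n) * (-1) ^+ n * Dfac * m * m * Dfac * m * m
   * (ep (- h *+ 7) * ep (1 * A) * ep (h *+ 6) * ep (- h *+ 3))); last by ring.
rewrite signrr !mul1r !epM //; congr (_ * ep _); rewrite Ah; ring.
Qed.

Lemma pow3_ep : exists z, (3 : R) ^+ n * 3 ^+ n = ep z.
Proof. exact: (@fermat_ep 3 coprime_p3). Qed.

Lemma pow_div3 (a : R) k : (a / 3) ^+ k * (a / 3) ^+ k = a ^+ k * a ^+ k / (3 ^+ k * 3 ^+ k).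
Proof.
rewrite !exprMn !exprVn invrM ?unitrX ?unitR3 //; ring.
Qed.

(** If 3^(p-1) is [ep z], the two squares are [Dfac ^+ 2] times [ep] of -5h - z and of -17h - 3z.
    The weights 3 and -1 of the extrapolation eliminate the Fermat quotient z of 3. *)
Lemma values_square : 3 * value1 ^+ 2 - value2 ^+ 2 = 2 * Dfac ^+ 2 * ep h.
Proof.
have [z hz] := pow3_ep.
have sgn : (-1) ^+ n * (-1) ^+ M * ((-1) ^+ n * (-1) ^+ M) = 1 :> R.
  by rewrite mulrACA !signrr mulr1.
have e8 : (8 / 3 : R) ^+ n * (8 / 3) ^+ n = ep (- h *+ 3 - z).
  rewrite pow_div3 hz epV //.
  have -> : (8 : R) ^+ n * 8 ^+ n = (2 ^+ n * 2 ^+ n) ^+ 3.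
    have -> : 8 = 2 * 2 * 2 :> R by ring.
    by rewrite !exprMn; ring.
  by rewrite pow4_h epX // epM.
have e2 : (2 / 3 : R) ^+ (3 * n) * (2 / 3) ^+ (3 * n) = ep (- h *+ 3 - z *+ 3).
  rewrite mulnC !exprM -exprMn pow_div3 hz epV // pow4_h epM // epX //.
  by congr ep; ring.
have -> : value1 ^+ 2 = Dfac ^+ 2 * ep (- h *+ 5 - z).
  rewrite value1E.
  transitivity ((-1) ^+ n * (-1) ^+ M * ((-1) ^+ n * (-1) ^+ M) * Dfac ^+ 2 *
    ((8 / 3) ^+ n * (8 / 3) ^+ n * ep (- h) * ep (- h)) : R); first by ring.
  by rewrite sgn mul1r e8 !epM //; congr (_ * ep _); ring.
have -> : value2 ^+ 2 = Dfac ^+ 2 * ep (- h *+ 17 - z *+ 3).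
  rewrite value2E.
  transitivity ((-1) ^+ n * (-1) ^+ M * ((-1) ^+ n * (-1) ^+ M) * Dfac ^+ 2 *
    ((2 / 3) ^+ (3 * n) * (2 / 3) ^+ (3 * n) * ep (- h *+ 7) * ep (- h *+ 7)) : R); first by ring.
  by rewrite sgn mul1r e2 !epM //; congr (_ * ep _); ring.
by rewrite /ep; ring.
Qed.

Lemma values_extrapolate :
  (3 * value1 ^+ 2 - value2 ^+ 2) * (2 ^+ n * 2 ^+ n) = 2 * Dfac ^+ 2.
Proof. by rewrite values_square pow4_h -[LHS]mulrA epM // subrr ep0 mulr1. Qed.

End ClosedFormReduction.

(** * Extrapolation to the parameter -1/2 *)

Section Interpolation.

Variable p : nat.
Hypothesis p_pr : prime p.
Hypothesis p_gt3 : (3 < p)%N.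
Notation R := 'Z_(p ^ 2)%N.
Notation unit := GRing.unit.
Notation n := (p./2).
Notation M := (p./2./2).

(** A first-order Taylor expansion in c p, with no remainder since p^2 = 0. *)
Definition affine_modp2 (g : R -> R) := exists d, forall c, g c = g 0 + c * p%:R * d.

Lemma affine_const a : affine_modp2 (fun=> a).
Proof. by exists 0 => c; rewrite mulr0 addr0. Qed.

Lemma affineD f g : affine_modp2 f -> affine_modp2 g -> affine_modp2 (fun c => f c + g c).
Proof. by move=> [d hd] [e he]; exists (d + e) => c; rewrite (hd c) (he c); ring. Qed.

Lemma affineM f g : affine_modp2 f -> affine_modp2 g -> affine_modp2 (fun c => f c * g c).
Proof.
move=> [d hd] [e he]; exists (f 0 * e + g 0 * d) => c; rewrite (hd c) (he c).
transitivity (f 0 * g 0 + c * p%:R * (f 0 * e + g 0 * d) + p%:R * p%:R * (c * c * d * e)); first by ring.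
by rewrite pp0 // mul0r addr0.
Qed.

(** The geometric series of the inverse stops after its linear term. *)
Lemma affineV f : affine_modp2 f -> f 0 \is a unit -> affine_modp2 (fun c => (f c)^-1).
Proof.
move=> [d hd] u0; exists (- d * (f 0)^-1 ^+ 2) => c.
have uc : f c \is a unit by rewrite hd [c * _]mulrC -mulrA; apply: unitR_addp.
apply: (mulIr uc); rewrite mulVr // (hd c).
have := divrr u0; move: (f 0) (f 0)^-1 => u w uw.
transitivity (u / 1 * w + c * p%:R * d * w * (1 - u * w) - p%:R * p%:R * (c * d * w) ^+ 2).
  by rewrite divr1 uw pp0 // subrr mulr0 mul0r addr0 subr0.
by rewrite divr1; ring.
Qed.

Lemma affine_sum k (F : 'I_k -> R -> R) :
  (forall i, affine_modp2 (F i)) -> affine_modp2 (fun c => \sum_i F i c).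
Proof.
move=> h; elim: k F h => [|k IH] F h.
  by exists 0 => c; rewrite !big_ord0 mulr0 addr0.
have [d hd] := IH (fun i => F (widen_ord (leqnSn k) i)) (fun i => h _).
have [e he] := h ord_max; exists (d + e) => c.
by rewrite !big_ord_recr /= hd he; ring.
Qed.

Lemma affine_prod k (F : 'I_k -> R -> R) :
  (forall i, affine_modp2 (F i)) -> affine_modp2 (fun c => \prod_i F i c).
Proof.
move=> h; elim: k F h => [|k IH] F h.
  by exists 0 => c; rewrite !big_ord0 mulr0 addr0.
have hF := IH (fun i => F (widen_ord (leqnSn k) i)) (fun i => h _).
have [d hd] := affineM hF (h ord_max); exists d => c.
by have := hd c; rewrite !big_ord_recr.
Qed.

Lemma affine_extrapolate g : affine_modp2 g -> 2 * g 0 = 3 * g 1 - g 3.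
Proof. by move=> [d hd]; rewrite (hd 1) (hd 3); ring. Qed.

(* The parameter x = -1/2 + c p/2: the sums of the theorem live at c = 0, while c = 1 and c = 3
   give the natural numbers (p-1)/2 and (3p-1)/2, where the series terminate. *)
Definition base (c : R) : R := (c * p%:R - 1) / 2.

Lemma base_double c : 2 * base c = c * p%:R - 1.
Proof. by rewrite mulrC mulrVK //; exact: unitR2. Qed.

Lemma base_nat c : (odd c) -> base c%:R = ((c * p).-1./2)%:R.
Proof.
move=> oc; apply: (mulrI (unitR2 p_pr p_gt3)).
rewrite base_double -natrM.
have op : odd (c * p) by rewrite oddM oc (pE p_pr p_gt3) oddD mul2n odd_double.
have e : (c * p = 2 * (c * p).-1./2 + 1)%N by lia.
by rewrite {1}e natrD addrK natrM.
Qed.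

Lemma affine_base : affine_modp2 base.
Proof. by exists 2^-1 => c; rewrite /base; ring. Qed.

Lemma affine_trm k : (k < p)%N -> affine_modp2 (fun c => trm (base c) k).
Proof.
move=> kp; rewrite /trm; apply: affine_prod => j.
have lin a b : affine_modp2 (fun c => a * base c + b).
  by apply: affineD (affine_const _); apply: affineM affine_base; exact: affine_const.
apply: affineM.
  by apply: affineM; apply: affineD affine_base (affine_const _).
apply: affineV.
  apply: affineM (affine_const _); apply: affineM (affine_const _) _.
  apply: affineD (affine_const _); apply: affineD (affine_const _).
  by apply: affineM affine_base; exact: affine_const.
rewrite base_double mul0r.
have -> : 0 - 1 + 2 * j%:R + 3 = 2 * (j.+1)%:R :> R by rewrite -[j.+1%:R]natr1; ring.
have -> : j%:R + 1 = j.+1%:R :> R by rewrite natr1.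
have uj : (j.+1%:R : R) \is a unit.
  by apply: unitR_small => //; have := ltn_ord j; lia.
have -> : (18 : R) = 2 * 3 * 3 by ring.
by rewrite !unitrM uj !(unitR2 p_pr p_gt3) !(unitR3 p_pr p_gt3).
Qed.

Lemma affine_Tsum : affine_modp2 (fun c => Tsum p (base c)).
Proof. by apply: affine_sum => i; apply: affine_trm. Qed.

Lemma affine_Hsum : affine_modp2 (fun c => Hsum p (base c)).
Proof.
apply: affine_sum => i; apply: affineM; last exact: affine_trm.
apply: affineD (affine_const _); apply: affineD; first exact: affine_const.
by apply: affineM affine_base; exact: affine_const.
Qed.

(** The hypothesis turns the factor 2N + 2j + 3 of the denominator into 2 (j + 1) + c p, a unit
    because j + 1 < p. *)
Lemma reduces_trm (N c k : nat) : (2 * N + 1 = c * p)%N -> (k < p)%N ->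
  reduces (trm N%:R k) (trm N%:R k : R).
Proof.
move=> Nc kp; apply: reduces_prod => // j _.
have n1 : reduces 1 (1 : R) by exact: reduces1.
have rn a : reduces a%:R (a%:R : R) by exact: reduces_nat.
have mj : reduces (2 * (j : nat)%:R) (2 * (j : nat)%:R : R) by apply: reducesM.
have uj : (j%:R + 1 : R) \is a unit.
  have -> : j%:R + 1 = j.+1%:R :> R by rewrite natr1.
  by apply: unitR_small => //; have := ltn_ord j; lia.
apply: reduces_div => //.
- have -> : (18 : R) = 2 * 3 * 3 by ring.
  rewrite !unitrM uj !(unitR2 p_pr p_gt3) !(unitR3 p_pr p_gt3) /= andbT.
  have -> : 2 * N%:R + 2 * j%:R + 3 = 2 * (j%:R + 1) + p%:R * c%:R :> R.
    transitivity ((2 * N + 1)%N%:R + 2 * j%:R + 2 : R); first by rewrite natrD natrM; ring.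
    by rewrite Nc natrM; ring.
  by apply: unitR_addp => //; rewrite unitrM uj (unitR2 p_pr p_gt3).
- by apply: reducesM => //; apply: reducesB => //; apply: reducesD.
- apply: reducesM; [exact: p_pr| |exact: reducesD].
  apply: reducesM => //; apply: reducesD => //; apply: reducesD => //.
  exact: reducesM.
Qed.

Lemma reduces_Tsum (N c : nat) : (2 * N + 1 = c * p)%N ->
  reduces (Tsum p N%:R) (Tsum p N%:R : R).
Proof. by move=> Nc; apply: reduces_sum => // i _; apply: reduces_trm Nc _. Qed.

Lemma reduces_Hsum (N c : nat) : (2 * N + 1 = c * p)%N ->
  reduces (Hsum p N%:R) (Hsum p N%:R : R).
Proof.
move=> Nc; apply: reduces_sum => // i _; apply: reducesM => //; last exact: reduces_trm Nc _.
have rn a : reduces a%:R (a%:R : R) by exact: reduces_nat.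
by apply: reducesD => //; apply: reducesD => //; apply: reducesM.
Qed.

End Interpolation.

(** * The product f h and the squares of f and h *)

Section SpecialValues.

Variable p : nat.
Hypothesis p_pr : prime p.
Hypothesis p_gt3 : (3 < p)%N.
Notation R := 'Z_(p ^ 2)%N.
Notation unit := GRing.unit.
Notation n := (p./2).
Notation M := (p./2./2).
Notation A := (harm p n).

Definition THval (N : nat) : rat :=
  6 * (16 / 9) ^+ N * (2 * N + 1)`!%:R ^+ 2 / (N`!%:R * (3 * N + 1)`!%:R).

Lemma THval1E : THval n = 6 * (16 / 9) ^+ n * p%:R * ((-1) ^+ n * rising (-1 * p%:R) n)
  / rising (1 * p%:R) n.
Proof.
rewrite /THval -(pE p_pr p_gt3).
have -> : (3 * n + 1 = 1 * p + n)%N by have := pE p_pr p_gt3; lia.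
rewrite fact_mulD mul1n pfactE //.
have h1 := fact_predB p_pr p_gt3 (n_le p_pr p_gt3).
have e : (p.-1 - n = n)%N by have := pE p_pr p_gt3; lia.
rewrite e in h1; rewrite h1.
have := @rising_neq0 p p_pr p_gt3 1 _ (n_small p_pr p_gt3); rewrite rmorph1.
have := @rising_neq0 p p_pr p_gt3 (-1) _ (n_small p_pr p_gt3); rewrite rmorphN1.
move: (fact_neq0 rat n) (signr_eq0 rat n) (p_neq0 p_pr p_gt3).
move: ((-1) ^+ n : rat) ((16 / 9) ^+ n : rat) => a b ? /negbT ? ? ? ?.
by field; repeat (apply/andP; split).
Qed.

(** For N = 3n + 1 one has N = p + n, 2N + 1 = 3p and 3N + 1 = 4p + n. Of the six factors p in the
    square of (3p)! five cancel. *)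
Lemma THval2E : THval (3 * n + 1) = 16 * (16 / 9) ^+ (3 * n) * p%:R *
   (rising (1%:R * p%:R) (2 * n) * rising (2%:R * p%:R) (2 * n))
  / (rising (3%:R * p%:R) (2 * n) * (rising (1 * p%:R) n * rising (4%:R * p%:R) n)).
Proof.
rewrite /THval.
have -> : (2 * (3 * n + 1) + 1 = 3 * p)%N by have := pE p_pr p_gt3; lia.
have -> : (3 * (3 * n + 1) + 1 = 4 * p + n)%N by have := pE p_pr p_gt3; lia.
have -> : (3 * n + 1 = 1 * p + n)%N by have := pE p_pr p_gt3; lia.
rewrite !fact_mulD.
have -> : (1 * p + n = 3 * n + 1)%N by have := pE p_pr p_gt3; lia.
rewrite !(fact_mulS p_pr p_gt3 3) (exprD _ _ 1) expr1.
have e3 := fact_mulS p_pr p_gt3 2.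
rewrite expr2 {1}e3 !(fact_mulS p_pr p_gt3 1).
have n2 : (2 * n < p)%N by have := pE p_pr p_gt3; lia.
have h1 := @rising_neq0 p p_pr p_gt3 1 _ (n_small p_pr p_gt3).
have h3 := @rising_neq0 p p_pr p_gt3 3 _ n2.
have h4 := @rising_neq0 p p_pr p_gt3 4 _ (n_small p_pr p_gt3).
move: h1 h3 h4 (fact_neq0 rat (3 * p)) (fact_neq0 rat (1 * p)) (p_neq0 p_pr p_gt3).
rewrite -[1%:~R]/(1 : rat) -[3%:~R]/(3 : rat) -[4%:~R]/(4 : rat).
move: ((16 / 9) ^+ (3 * n) : rat) => b *.
by field; repeat (apply/andP; split).
Qed.

(** (16/9)^n = (4/3)^(p-1) is 1 modulo p. *)
Lemma pow16_9 k : exists z, (16 / 9 : R) ^+ (k * n) = ep z.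
Proof.
have [z hz] := pow3_ep p_pr p_gt3.
have [y hy] : exists y, (2 : R) ^+ n * 2 ^+ n = ep y by rewrite pow4_h //; eexists.
exists ((y *+ 2 - z) *+ k); rewrite mulnC exprM -epX //; congr (_ ^+ k).
rewrite exprMn exprVn.
have -> : (16 : R) ^+ n = (2 ^+ n * 2 ^+ n) ^+ 2.
  by have -> : 16 = 2 * 2 * 2 * 2 :> R; [ring | rewrite !exprMn; ring].
have -> : (9 : R) ^+ n = 3 ^+ n * 3 ^+ n by rewrite -exprMn; congr (_ ^+ _); ring.
by rewrite hz hy epX // epV // epM.
Qed.

Lemma coprime_p9 : coprime p 9.
Proof. by rewrite (@coprimeMr p 3 3) coprime_p3. Qed.

Lemma reduces_THval1 : reduces (THval n) (6 * p%:R * (-1) ^+ n : R).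
Proof.
have np := n_small p_pr p_gt3.
have un := unitR_fact p_pr p_gt3 np.
have r1 : reduces 1 (1 : R) by exact: reduces1.
have rm1 : reduces (-1) (-1 : R) by apply: reducesN.
have -> : 6 * p%:R * (-1) ^+ n = 6 * (16 / 9) ^+ n * p%:R
   * ((-1) ^+ n * (n`!%:R * ep (-1 * A))) / (n`!%:R * ep (1 * A)) :> R.
  have [z] := pow16_9 1; rewrite mul1n => ->.
  apply/esym/inv_eq; first by rewrite unitrM un ep_unit.
  transitivity (6 * ((p%:R * ep z) * ep (-1 * A)) * (-1) ^+ n * n`!%:R : R); first by ring.
  rewrite !p_ep // -{1}(p_ep p_pr (1 * A)); ring.
rewrite THval1E; apply: reduces_div => //; last exact: reduces_rising.
  by rewrite unitrM un ep_unit.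
apply: reducesM => //; last first.
  by apply: reducesM => //; [exact: reduces_sign | exact: reduces_rising].
apply: reducesM => //; last exact: reduces_nat.
apply: reducesM => //; first exact: (reduces_nat p 6).
exact: (reduces_powdiv p_pr 16 _ coprime_p9).
Qed.

Lemma reduces_THval2 : reduces (THval (3 * n + 1)) (16 * p%:R * (-1) ^+ n : R).
Proof.
have np := n_small p_pr p_gt3.
have un := unitR_fact p_pr p_gt3 np.
have r1 : reduces 1 (1 : R) by exact: reduces1.
have rn a : reduces a%:R (a%:R : R) by exact: reduces_nat.
pose r (c : nat) : R := n`!%:R * ep (c%:R * A) * ((-1) ^+ n * (n`!%:R * ep (- c.+1%:R * A))).
have rr c : reduces (rising (c%:R * p%:R) (2 * n)) (r c).
  rewrite rising_double //; apply: reducesM => //; first exact: reduces_rising.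
  apply: reducesM => //; first exact: reduces_sign.
  by apply: reduces_rising => //; apply: reducesN.
have ur c : r c \is a unit by rewrite /r !unitrM un !ep_unit // unit_sign.
have -> : 16 * p%:R * (-1) ^+ n = 16 * (16 / 9) ^+ (3 * n) * p%:R * (r 1%N * r 2%N)
   / (r 3%N * ((n`!%:R * ep (1 * A)) * (n`!%:R * ep (4%:R * A)))) :> R.
  have [z ->] := pow16_9 3.
  have pr c : p%:R * r c = p%:R * (-1) ^+ n * n`!%:R * n`!%:R.
    transitivity ((p%:R * ep (c%:R * A)) * ep (- c.+1%:R * A) * (-1) ^+ n * n`!%:R * n`!%:R);
      first by rewrite /r; ring.
    by rewrite !p_ep.
  apply/esym/inv_eq; first by rewrite unitrM ur !unitrM un !ep_unit.
  transitivity (16 * (p%:R * r 1%N) * ep z * r 2%N : R); first by ring.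
  rewrite pr.
  transitivity (16 * ((p%:R * ep z) * r 2%N) * (-1) ^+ n * n`!%:R * n`!%:R : R); first by ring.
  rewrite p_ep // pr.
  transitivity (16 * (-1) ^+ n * n`!%:R * n`!%:R * (p%:R * r 3%N)); first by rewrite pr; ring.
  rewrite -{1}(p_ep p_pr (1 * A)) -{1}(p_ep p_pr (4%:R * A)); ring.
rewrite THval2E; apply: reduces_div => //.
- by rewrite unitrM ur !unitrM un !ep_unit.
- apply: reducesM => //; last exact: reducesM.
  apply: reducesM => //; apply: reducesM => //.
  exact: (reduces_powdiv p_pr 16 _ coprime_p9).
- apply: reducesM => //; apply: reducesM => //; first exact: reduces_rising.
  by apply: reduces_rising.
Qed.

Lemma base1 : base 1 = n%:R :> R.
Proof. by rewrite -[1]/(1%:R) base_nat // mul1n; congr _%:R; have := pE p_pr p_gt3; lia. Qed.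

Lemma base3 : base 3 = (3 * n + 1)%N%:R :> R.
Proof. by rewrite base_nat //; congr _%:R; have := pE p_pr p_gt3; lia. Qed.

Notation f := (Tsum p (base 0 : R)).
Notation h := (Hsum p (base 0 : R)).

Lemma n_idx : (2 * n + 1 = 1 * p)%N. Proof. by have := pE p_pr p_gt3; lia. Qed.
Lemma n3_idx : (2 * (3 * n + 1) + 1 = 3 * p)%N. Proof. by have := pE p_pr p_gt3; lia. Qed.

(** Both interpolated products are p times a number that matters only modulo p: 6 and 16, with the
    common sign (-1)^n. Finally 3 * 6 - 16 = 2. *)
Lemma TH_special : f * h = p%:R * (-1) ^+ n.
Proof.
have := affine_extrapolate (affineM p_pr (affine_Tsum p_pr p_gt3) (affine_Hsum p_pr p_gt3)).
rewrite base1 base3.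
have T1 := reduces_Tsum p_pr p_gt3 n_idx; have H1 := reduces_Hsum p_pr p_gt3 n_idx.
have T3 := reduces_Tsum p_pr p_gt3 n3_idx; have H3 := reduces_Hsum p_pr p_gt3 n3_idx.
have := reducesM p_pr T1 H1; rewrite THsum => [/(reduces_eq p_pr) h1|]; last by have := n_idx; lia.
have := reducesM p_pr T3 H3; rewrite THsum => [/(reduces_eq p_pr) h3|]; last by have := n3_idx; lia.
rewrite [X in 3 * X - _](h1 _ reduces_THval1) [X in _ - X](h3 _ reduces_THval2) => e.
by apply: (mulrI (unitR2 p_pr p_gt3)); rewrite e; ring.
Qed.

Lemma Tsum_closed : ~~ odd n ->
  Tsum p (n%:R : rat) = closed1 p /\ Tsum p ((3 * n + 1)%N%:R : rat) = closed2 p.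
Proof.
move=> on; have e := pE p_pr p_gt3.
have nE : n = (2 * M)%N by lia.
have pM : p = (4 * M + 1)%N by lia.
have e1 : (p.-1 - M = 3 * M)%N by lia.
have e2 : (p + n = 6 * M + 1)%N by lia.
split.
  rewrite /closed1 e1 e2 {1 2}nE Tsum_even; last by lia.
  rewrite -pM exprM; congr (_ ^+ _ * _ * _ / _).
have -> : (3 * n + 1 = 2 * (3 * M) + 1)%N by lia.
rewrite /closed2 Tsum_odd; last by lia.
rewrite e1 e2.
have -> : (4 * (3 * M) + 3 = 3 * p)%N by lia.
have -> : (2 * p + M = 3 * (3 * M) + 2)%N by lia.
have -> : (3 * n + 1 = 2 * (3 * M) + 1)%N by lia.
have -> : (2 * (3 * M) + 2 = 6 * M + 1 + 1)%N by lia.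
rewrite !(natr_factD1 rat (3 * M)) (natr_factD1 rat (6 * M + 1)) (natrD1 rat (6 * M)).
rewrite (natrM _ 3) (natrM _ 6).
move: (fact_neq0 rat (6 * M + 1)) (fact_neq0 rat (3 * (3 * M) + 2)) (ler0n rat M).
move: (M%:R : rat) ((2 / 3) ^+ _ : rat) ((3 * p)`!%:R : rat) => x b c ? ? ?.
by clear e nE pM e1 e2; field; repeat (apply/andP; split) => //; lra.
Qed.

Lemma Hsum_closed : odd n ->
  Hsum p (n%:R : rat) = 12 * closed1 p /\ Hsum p ((3 * n + 1)%N%:R : rat) = 12 * closed2 p.
Proof.
move=> on; have e := pE p_pr p_gt3.
have nE : n = (2 * M + 1)%N by lia.
have pM : p = (4 * M + 3)%N by lia.
have e1 : (p.-1 - M = 3 * M + 2)%N by lia.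
have e2 : (p + n = 6 * M + 4)%N by lia.
split.
  rewrite /closed1 e1 e2 {1 2}nE Hsum_odd; last by lia.
  rewrite -pM -nE.
  have -> : (2 * M + 2 = 2 * (M + 1))%N by lia.
  rewrite natrM (natr_factD1 rat M) natrD1.
  move: (fact_neq0 rat (6 * M + 4)) (fact_neq0 rat M) (ler0n rat M).
  move: (M%:R : rat) ((8 / 3) ^+ _ : rat) (p`!%:R : rat) => x b c ? ? ?.
  by clear e nE pM e1 e2; field; repeat (apply/andP; split) => //; lra.
have -> : (3 * n + 1 = 2 * (3 * M + 2))%N by lia.
rewrite /closed2 Hsum_even; last by lia.
rewrite e1 e2.
have -> : (4 * (3 * M + 2) + 1 = 3 * p)%N by lia.
have -> : (2 * p + M = 3 * (3 * M + 2))%N by lia.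
have -> : (3 * n + 1 = 2 * (3 * M + 2))%N by lia.
have -> : (2 * (3 * M + 2) = 6 * M + 4)%N by lia.
have -> : (2 / 3 : rat) ^+ (6 * M + 4) = (4 / 9) ^+ (3 * M + 2).
  have -> : (6 * M + 4 = 2 * (3 * M + 2))%N by lia.
  by rewrite exprM; congr (_ ^+ _); field.
move: (fact_neq0 rat (6 * M + 4)) (fact_neq0 rat (3 * (3 * M + 2))).
move: ((4 / 9) ^+ _ : rat) ((3 * p)`!%:R : rat) => b c ? ?.
by field; repeat (apply/andP; split).
Qed.

Lemma Tsum_sq : ~~ odd n -> f ^+ 2 * (2 ^+ n * 2 ^+ n) = Dfac p ^+ 2.
Proof.
move=> on; have [c1 c2] := Tsum_closed on.
have := affine_extrapolate (affineM p_pr (affine_Tsum p_pr p_gt3) (affine_Tsum p_pr p_gt3)).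
rewrite base1 base3.
have := reduces_Tsum p_pr p_gt3 n_idx; rewrite c1 => /(reduces_eq p_pr) h1.
have := reduces_Tsum p_pr p_gt3 n3_idx; rewrite c2 => /(reduces_eq p_pr) h2.
rewrite (h1 _ (reduces_closed1 p_pr p_gt3)) (h2 _ (reduces_closed2 p_pr p_gt3)) -!expr2 => e.
apply: (mulrI (unitR2 p_pr p_gt3)).
by rewrite -(values_extrapolate p_pr p_gt3) -e [LHS]mulrA.
Qed.

Lemma Hsum_sq : odd n -> h ^+ 2 * (2 ^+ n * 2 ^+ n) = 144 * Dfac p ^+ 2.
Proof.
move=> on; have [c1 c2] := Hsum_closed on.
have := affine_extrapolate (affineM p_pr (affine_Hsum p_pr p_gt3) (affine_Hsum p_pr p_gt3)).
rewrite base1 base3.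
have r12 : reduces 12 (12 : R) by exact: (reduces_nat p 12).
have := reduces_Hsum p_pr p_gt3 n_idx; rewrite c1 => /(reduces_eq p_pr) h1.
have := reduces_Hsum p_pr p_gt3 n3_idx; rewrite c2 => /(reduces_eq p_pr) h2.
rewrite (h1 _ (reducesM p_pr r12 (reduces_closed1 p_pr p_gt3))).
rewrite (h2 _ (reducesM p_pr r12 (reduces_closed2 p_pr p_gt3))) -!expr2 => e.
apply: (mulrI (unitR2 p_pr p_gt3)).
rewrite [RHS]mulrCA -(values_extrapolate p_pr p_gt3) [LHS]mulrA e; ring.
Qed.

End SpecialValues.

(** * Teichmueller representatives and the Jacobi sum *)

Section Teichmuller.

Variable p : nat.
Hypothesis p_pr : prime p.
Hypothesis p_gt3 : (3 < p)%N.
Notation R := 'Z_(p ^ 2)%N.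
Notation unit := GRing.unit.
Notation n := (p./2).
Notation M := (p./2./2).

(** In X^p - Y^p = (X - Y) (X^(p-1) + ... + Y^(p-1)) the p summands agree modulo p, which supplies a
    second factor p. *)
Lemma expp_addp (x z : R) : (x + p%:R * z) ^+ p = x ^+ p.
Proof.
have pM (k : nat) : p%:R * (x + p%:R * z) ^+ k = p%:R * x ^+ k.
  elim: k => [|k IH]; first by rewrite !expr0.
  rewrite exprSr mulrA IH exprSr mulrDr.
  transitivity (p%:R * (x ^+ k * x) + p%:R * p%:R * (x ^+ k * z)); first by ring.
  by rewrite pp0 // mul0r addr0.
apply/eqP; rewrite -subr_eq0 subrXX addrAC subrr add0r mulrAC mulr_sumr.
rewrite (eq_bigr (fun=> p%:R * x ^+ p.-1)) => [|i _].
  by rewrite sumr_const card_ord -[(_ * _) *+ _]mulr_natl mulrA pp0 // !mul0r.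
by rewrite mulrA pM -mulrA -exprD; congr (_ * _ ^+ _); have := ltn_ord i; lia.
Qed.

Lemma exp_addp (x z : R) k :
  (x + p%:R * z) ^+ k.+1 = x ^+ k.+1 + k.+1%:R * x ^+ k * (p%:R * z).
Proof.
elim: k => [|k IH]; first by rewrite !expr1 expr0 mulr1 mul1r.
rewrite exprS IH [in RHS]exprS.
transitivity (x * x ^+ k.+1 + k.+1%:R * (x * x ^+ k) * (p%:R * z) + x ^+ k.+1 * (p%:R * z)
  + p%:R * p%:R * (z * z * k.+1%:R * x ^+ k)); first by ring.
rewrite pp0 // mul0r addr0 -!exprS -[k.+2]addn1 natrD; ring.
Qed.

Lemma Fp_congr (a b : nat) : a%:R = b%:R :> 'F_p -> exists z : R, a%:R = b%:R + p%:R * z.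
Proof.
move=> /(congr1 val) /=; rewrite !val_Fp_nat // => e.
exists ((a %/ p)%:R - (b %/ p)%:R).
rewrite {1}(divn_eq a p) {1}(divn_eq b p) e !natrD !natrM; ring.
Qed.

Lemma natFp_val (t : 'F_p) : t = (val t)%:R.
Proof. by rewrite natr_Zp. Qed.

Lemma val_Fp_lt (t : 'F_p) : (val t < p)%N.
Proof. by rewrite -[X in (_ < X)%N](Fp_cast p_pr) ltn_ord. Qed.

(** The p-th power of any lift is the Teichmueller representative modulo p^2, so multiplicative
    characters of F_p take their values in R itself. *)
Definition tau (t : 'F_p) : R := (val t)%:R ^+ p.

Lemma tau_nat (a : nat) : tau a%:R = a%:R ^+ p.
Proof.
have e : val (a%:R : 'F_p) = (a %% p)%N := val_Fp_nat p_pr a.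
rewrite /tau e [in RHS](divn_eq a p) natrD natrM addrC mulrC.
by rewrite [RHS]expp_addp.
Qed.

Lemma tauM t u : tau (t * u) = tau t * tau u.
Proof. by rewrite {1}[t]natFp_val {1}[u]natFp_val -natrM tau_nat natrM exprMn. Qed.

Lemma tau0 : tau 0 = 0.
Proof. by rewrite -[0]/(0%:R) tau_nat expr0n; case: (p) p_gt3. Qed.

Lemma tau1 : tau 1 = 1.
Proof. by rewrite -[1]/(1%:R) tau_nat expr1n. Qed.

Lemma tauX t k : tau (t ^+ k) = tau t ^+ k.
Proof. by elim: k => [|k IH]; rewrite ?expr0 ?tau1 // !exprS tauM IH. Qed.

Lemma coprime_val (t : 'F_p) : t != 0 -> coprime p (val t).
Proof.
move=> t0; rewrite prime_coprime // gtnNdvd ?val_Fp_lt // lt0n.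
by apply: contraNneq t0 => e; rewrite [t]natFp_val e.
Qed.

Lemma tau_ord t : t != 0 -> tau t ^+ p.-1 = 1.
Proof.
move=> /coprime_val ct; rewrite /tau -exprM -natrX.
have := @Euler_exp_totient (val t) (p ^ 2); rewrite coprime_sym coprime_pexpl // => /(_ ct).
rewrite totient_pfactor // expn1 mulnC => e.
by rewrite -[LHS]Zp_nat_mod ?p2_gt1 // e Zp_nat_mod ?p2_gt1.
Qed.

Lemma fermatR (x : R) : exists z, x ^+ p = x + p%:R * z.
Proof.
rewrite [x]natR_val -natrX; apply: Fp_congr; apply: val_inj => /=.
by rewrite !val_Fp_nat // fermat_little.
Qed.

Lemma tau_val t : exists z, tau t = (val t)%:R + p%:R * z.
Proof. exact: fermatR. Qed.

Lemma tau_sub_unit t u : t != u -> tau t - tau u \is a unit.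
Proof.
move=> tu; have [z ->] := tau_val t; have [w ->] := tau_val u.
have -> : (val t)%:R + p%:R * z - ((val u)%:R + p%:R * w)
  = ((val t)%:Z - (val u)%:Z)%:~R + p%:R * (z - w) :> R by rewrite rmorphB /=; ring.
apply: unitR_addp => //; rewrite unitR_int // prime_coprime // gtnNdvd //.
  rewrite absz_gt0 subr_eq0 eqz_nat; apply: contraNneq tu => e.
  by apply/eqP/val_inj.
by have := val_Fp_lt t; have := val_Fp_lt u; move: (val t) (val u) => a b; lia.
Qed.

Lemma tau_1B t : tau (1 - t) = (1 - tau t) ^+ p.
Proof.
have [w ->] := tau_val t.
have [z e] : exists z : R, (val (1 - t)%R + val t)%N%:R = 1%:R + p%:R * z.
  by apply: Fp_congr; rewrite natrD -!natFp_val subrK.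
rewrite natrD in e.
rewrite /tau; have -> : 1 - ((val t)%:R + p%:R * w) = (val (1 - t)%R)%:R + p%:R * (- z - w).
  have -> : (val (1 - t)%R)%:R = 1%:R + p%:R * z - (val t)%:R :> R by rewrite -e addrK.
  by ring.
by rewrite expp_addp.
Qed.

Definition psum (j : nat) : R := \sum_(t : 'F_p | t != 0) tau t ^+ j.

Lemma card_Fp_nz : #|[pred t : 'F_p | t != 0]| = p.-1.
Proof.
have := card_Fp p_pr; rewrite (cardD1 0) inE add1n => e.
apply: (etrans _ (congr1 predn e)).
by apply: eq_card => t; rewrite !inE andbT.
Qed.

Lemma psum_dvd j : (p.-1 %| j)%N -> psum j = p.-1%:R.
Proof.
move=> /dvdnP [k ->]; rewrite /psum (eq_bigr (fun=> 1)) => [|t t0].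
  by rewrite sumr_const card_Fp_nz.
by rewrite mulnC exprM tau_ord // expr1n.
Qed.

(** Replacing t by g t multiplies the sum by [tau g ^+ r], where r is j modulo p - 1 and g^r is not
    1; this factor minus 1 is a unit. *)
Lemma psum_ndvd j : ~~ (p.-1 %| j)%N -> psum j = 0.
Proof.
rewrite /dvdn => j0; set r := (j %% p.-1)%N in j0.
have rp : (r < p.-1)%N by rewrite ltn_mod; lia.
have -> : psum j = psum r.
  apply: eq_bigr => t t0.
  by rewrite {1}(divn_eq j p.-1) exprD mulnC exprM tau_ord // expr1n mul1r.
have [g g0 gr] : exists2 g : 'F_p, g != 0 & g ^+ r != 1.
  apply/exists_inP; apply: contraT; rewrite negb_exists_in => /forall_inP h.
  have := @max_unity_roots _ r (enum [pred t : 'F_p | t != 0]).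
  rewrite -cardE card_Fp_nz lt0n j0 enum_uniq => /(_ isT).
  rewrite leqNgt rp => h'; apply: h' => //.
  apply/allP => t; rewrite mem_enum inE => t0; rewrite unity_rootE.
  by have := h t t0; rewrite negbK.
have u := tau_sub_unit gr; rewrite tau1 tauX in u.
have e : tau g ^+ r * psum r = psum r.
  rewrite {2}/psum (reindex_inj (mulfI g0)) /= /psum mulr_sumr.
  apply: eq_big => [t|t _]; first by rewrite mulf_eq0 negb_or g0.
  by rewrite tauM exprMn.
by apply: (mulrI u); rewrite mulr0 mulrBl mul1r e subrr.
Qed.

Lemma psum_binomial (k e : nat) :
  \sum_(t : 'F_p | t != 0) tau t ^+ k * (1 - tau t) ^+ e
  = \sum_(j < e.+1) (-1) ^+ j * 'C(e, j)%:R * psum (k + j).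
Proof.
under eq_bigr => t _ do rewrite exprBn mulr_sumr.
rewrite exchange_big /=; apply: eq_bigr => j _.
rewrite /psum mulr_sumr; apply: eq_bigr => t _.
by rewrite expr1n mulr1 exprD -mulr_natr; ring.
Qed.

End Teichmuller.

(** * The Jacobi sum as a binomial coefficient *)

Section JacobiValue.

Variable p : nat.
Hypothesis p_pr : prime p.
Hypothesis p_gt3 : (3 < p)%N.
Notation R := 'Z_(p ^ 2)%N.
Notation unit := GRing.unit.
Notation n := (p./2).
Notation M := (p./2./2).
Hypothesis n_even : ~~ odd n.

Lemma nE : n = (2 * M)%N. Proof. by lia. Qed.
Lemma pE4 : p = (4 * M + 1)%N. Proof. by have := pE p_pr p_gt3; lia. Qed.
Lemma M_gt0 : (0 < M)%N. Proof. by have := pE4; lia. Qed.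

(* The Jacobi sum of the quartic and quadratic characters, through Teichmueller representatives. *)
Definition jac : R := \sum_(t : 'F_p) tau t ^+ (3 * M) * tau (1 - t) ^+ n.

(* tau^p = tau makes the p-th power in tau (1 - t) = (1 - tau t)^p linear in p. *)
Lemma pow_half (x : R) : (x ^+ p) ^+ n = (1 - n%:R) * x ^+ n + n%:R * x ^+ (3 * n).
Proof.
have [z e] := fermatR p_pr x.
have e' : n = n.-1.+1 by have := M_gt0; have := nE; lia.
have -> : (x ^+ p) ^+ n = x ^+ n + n%:R * x ^+ n.-1 * (x ^+ p - x).
  by rewrite e e' exp_addp // -e' addrAC subrr add0r.
have -> : x ^+ (3 * n) = x ^+ n.-1 * x ^+ p.
  by rewrite -exprD; congr (_ ^+ _); have := pE p_pr p_gt3; lia.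
have -> : x ^+ n = x ^+ n.-1 * x by rewrite -exprSr -e'.
ring.
Qed.

(** In the binomial expansions a power sum of exponent 3M + j survives only if 4M divides 3M + j:
    for j = M, and in the longer one also for j = 5M. The last two contributions are equal, whence
    the coefficient 2n. *)
Lemma jacE : jac = p.-1%:R * (-1) ^+ M
  * ((1 - n%:R) * 'C(2 * M, M)%:R + 2 * n%:R * 'C(6 * M, M)%:R).
Proof.
have M0 := M_gt0; have p4 := pE4; have nM := nE.
have -> : jac = (1 - n%:R) * \sum_(t : 'F_p | t != 0) tau t ^+ (3 * M) * (1 - tau t) ^+ n
    + n%:R * \sum_(t : 'F_p | t != 0) tau t ^+ (3 * M) * (1 - tau t) ^+ (3 * n).
  rewrite /jac (bigD1 0) //= tau0 // expr0n muln_eq0 /= (gtn_eqF M0) mul0r add0r.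
  rewrite !mulr_sumr -big_split /=; apply: eq_bigr => t _.
  by rewrite tau_1B // pow_half; ring.
rewrite !psum_binomial.
have dvd j : (j <= 2 * M)%N -> (p.-1 %| 3 * M + j)%N = (j == M).
  move=> jM; apply/idP/eqP => [/dvdnP [k]|->]; last by apply/dvdnP; exists 1%N; lia.
  by rewrite p4 addn1 /=; case: k => [|[|k]]; lia.
have dvd3 j : (j <= 6 * M)%N -> (p.-1 %| 3 * M + j)%N = (j == M) || (j == 5 * M)%N.
  move=> jM; apply/idP/orP => [/dvdnP [k]|].
    rewrite p4 addn1 /=; case: k => [|[|[|k]]] h; [lia|left|right|]; try apply/eqP; lia.
  by case=> /eqP ->; apply/dvdnP; [exists 1%N|exists 2]; lia.
have MO : (M < n.+1)%N by lia.
rewrite (bigD1 (Ordinal MO)) //= big1 => [|j jM].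
  have M1 : (M < (3 * n).+1)%N by lia.
  have M5 : (5 * M < (3 * n).+1)%N by lia.
  rewrite (bigD1 (Ordinal M1)) //= (bigD1 (Ordinal M5)) /=; last by rewrite -val_eqE /=; lia.
  rewrite big1 => [|j /andP [jM j5]].
    rewrite !psum_dvd // ?dvd3 ?eqxx ?orbT; try lia.
    have -> : (-1) ^+ (5 * M) = (-1) ^+ M :> R.
      by rewrite -signr_odd -[RHS]signr_odd oddM.
    have -> : 'C(3 * n, 5 * M) = 'C(6 * M, M).
      rewrite -bin_sub; last by lia.
      by congr 'C(_, _); lia.
    have -> : (3 * n = 6 * M)%N by lia.
    have -> : 'C(n, M) = 'C(2 * M, M) by rewrite -nM.
    by ring.
  rewrite psum_ndvd ?mulr0 // dvd3 ?negb_or; last by have := ltn_ord j; lia.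
  by rewrite -!val_eqE /= in jM j5; rewrite jM j5.
rewrite psum_ndvd ?mulr0 // dvd; last by have := ltn_ord j; lia.
by rewrite -!val_eqE /= in jM.
Qed.

Lemma central_binomial : 'C(2 * M, M)%:R = Dfac p.
Proof.
have uM := unitR_fact p_pr p_gt3 (M_small p_pr p_gt3).
apply/esym/inv_eq; first by rewrite unitrM uM.
have := @bin_fact (2 * M) M ltac:(lia); rewrite -nE => <-.
have -> : (n - M = M)%N by have := nE; lia.
by rewrite nE !natrM.
Qed.

Notation h := (harm p n / 2).

(** As 6M + 1 = p + n and 5M + 1 = p + M, the factorials become blocks starting at p, and the
    quotient of p + M by p + n remains, with 4 (p + M) = 5p - 1 and 2 (p + n) = 3p - 1. *)
Lemma binomial_6M : 2 * 'C(6 * M, M)%:R = Dfac p * ep (- h - 2).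
Proof.
have p4 := pE4; have nM := nE.
have np := n_small p_pr p_gt3; have Mp := M_small p_pr p_gt3.
have uM := unitR_fact p_pr p_gt3 Mp.
have un := unitR_fact p_pr p_gt3 np.
have r1 : reduces 1 (1 : R) by exact: reduces1.
have rn a : reduces a%:R (a%:R : R) by exact: reduces_nat.
have key : 'C(6 * M, M)%:R * (M`!%:R * rising (1 * p%:R) M * (p + n)%N%:R)
    = rising (1 * p%:R) n * (p + M)%N%:R :> rat.
  apply: (mulfI (fact_neq0 rat p)).
  have h1 := fact_mulD p 1 n; have h2 := fact_mulD p 1 M.
  rewrite !mul1n in h1 h2.
  transitivity ('C(6 * M, M)%:R * M`!%:R * (p`!%:R * rising (1 * p%:R) M) * (p + n)%N%:R : rat);
    first by ring.
  rewrite [RHS]mulrA -h1 -h2 -!natrM; congr _%:R.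
  have := @bin_fact (6 * M) M ltac:(lia).
  have -> : (6 * M - M = 5 * M)%N by lia.
  have -> : (p + n = (6 * M).+1)%N by lia.
  have -> : (p + M = (5 * M).+1)%N by lia.
  rewrite !factS => <-; nia.
have {}key : 'C(6 * M, M)%:R * (M`!%:R * (M`!%:R * ep (1 * harm p M)) * (p + n)%N%:R)
    = n`!%:R * ep (1 * harm p n) * (p + M)%N%:R :> R.
  apply: (@reduces_eq p p_pr (rising (1 * p%:R) n * (p + M)%N%:R)).
    rewrite -key; apply: reducesM => //; apply: reducesM => //; apply: reducesM => //.
    exact: reduces_rising.
  by apply: reducesM => //; exact: reduces_rising.
have u3 : ep (-3 : R) \is a unit by exact: (ep_unit p_pr).
have n2 : 2 * (p + n)%N%:R = - ep (-3) :> R.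
  have -> : 2 * (p + n)%N%:R = (2 * n + 1)%N%:R + 2 * p%:R - 1 :> R by rewrite (natrD R (2 * n)) (natrD R p) natrM; ring.
  by rewrite -(pE p_pr p_gt3) /ep; ring.
have M4 : 4 * (p + M)%N%:R = - ep (-5) :> R.
  have -> : 4 * (p + M)%N%:R = (4 * M + 1)%N%:R + 4 * p%:R - 1 :> R by rewrite (natrD R (4 * M)) (natrD R p) natrM; ring.
  by rewrite -p4 /ep; ring.
apply: (mulIr u3); apply: (mulIr uM); apply: (mulIr uM).
apply: (mulIr (ep_unit p_pr (harm p M))).
transitivity (- 4 * ('C(6 * M, M)%:R * (M`!%:R * (M`!%:R * ep (1 * harm p M)) * (p + n)%N%:R)) : R).
  by rewrite mul1r; transitivity ('C(6 * M, M)%:R * (M`!%:R * (M`!%:R * ep (harm p M)) *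
    (- 2 * (2 * (p + n)%N%:R))) : R); [rewrite n2; ring | ring].
rewrite key mul1r.
transitivity (- (n`!%:R * ep (harm p n) * (4 * (p + M)%N%:R)) : R); first by ring.
rewrite M4.
have -> : (n`!%:R : R) = Dfac p * (M`!%:R * M`!%:R) by rewrite /Dfac mulrVK // unitrM uM.
transitivity (Dfac p * M`!%:R * M`!%:R * (ep (harm p n) * ep (-5))); first by ring.
transitivity (Dfac p * M`!%:R * M`!%:R * (ep (- h - 2) * ep (-3) * ep (harm p M))); last by ring.
have -> : ep (harm p M) = ep (h *+ 3).
  by rewrite -[harm p M]opprK -epV // epB // epV //; congr ep; ring.
by rewrite !epM // {1}(Ah p_pr p_gt3); congr (_ * ep _); ring.
Qed.

(** The relation has the form of [Tsum_sq], which identifies f^2 with the square of the Jacobi sum;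
    for squares the sign of the sum is irrelevant. *)
Lemma jac_sq : jac ^+ 2 * (2 ^+ n * 2 ^+ n) = Dfac p ^+ 2.
Proof.
have u4 : (4 : R) \is a unit by have -> : (4 : R) = 2 * 2; [ring | rewrite unitrM (unitR2 p_pr p_gt3)].
have n2 : 2 * n%:R = p%:R - 1 :> R.
  have : (2 * n + 1)%N%:R = p%:R :> R by rewrite -pE.
  by rewrite natrD natrM => <-; rewrite addrK.
have p1 : p.-1%:R = - ep (-1) :> R.
  have -> : p.-1%:R = p.-1.+1%:R - 1 :> R by rewrite -natr1 addrK.
  by rewrite prednK ?prime_gt0 // /ep; ring.
have e : 2 * jac = - (-1) ^+ M * Dfac p * ep (-1) * (2 * (1 + p%:R) + p%:R * h).
  rewrite jacE central_binomial.
  transitivity (p.-1%:R * (-1) ^+ M * ((2 - 2 * n%:R) * Dfac p + 2 * n%:R * (2 * 'C(6 * M, M)%:R))).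
    ring.
  rewrite binomial_6M p1 n2.
  have -> : (p%:R - 1) * (Dfac p * ep (- h - 2)) = - Dfac p * (ep (-1) * ep (- h - 2)).
    by rewrite {2}/ep; ring.
  by rewrite epM // {2}/ep; ring.
apply: (mulrI u4).
transitivity ((2 * jac) ^+ 2 * (2 ^+ n * 2 ^+ n)); first by ring.
rewrite e.
have -> : (2 * (1 + p%:R) + p%:R * h) = 2 * ep 1 + p%:R * h by rewrite /ep; ring.
transitivity (((-1) ^+ M * (-1) ^+ M) * Dfac p ^+ 2 * (ep (-1) * ep (-1))
  * (4 * (ep 1 * ep 1) + 4 * (p%:R * ep 1) * h + p%:R * p%:R * h * h) * (2 ^+ n * 2 ^+ n) : R).
  by ring.
rewrite signrr pp0 // p_ep // !epM // pow4_h // !mul0r addr0 mul1r.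
have -> : 4 * ep (1 + 1) + 4 * p%:R * h = 4 * ep (1 + 1 + h) by rewrite /ep; ring.
transitivity (4 * Dfac p ^+ 2 * (ep (-1 - 1) * ep (1 + 1 + h) * ep (- h))); first by ring.
rewrite !epM //; have -> : -1 - 1 + (1 + 1 + h) - h = 0 by ring.
by rewrite ep0 mulr1.
Qed.

End JacobiValue.

(** p divides (ad - bc)(ad + bc). In p^2 = (ac + 4bd)^2 + 4 (ad - bc)^2, or the same with both inner
    signs changed, a second base divisible by p must be 0. *)
Lemma two_squares_unique (p : nat) (a b c d : int) : prime p ->
  a ^+ 2 + 4 * b ^+ 2 = p%:Z -> c ^+ 2 + 4 * d ^+ 2 = p%:Z -> a ^+ 2 = c ^+ 2.
Proof.
move=> p_pr ab cd.
have p0 : 0 < p%:Z by rewrite ltz_nat prime_gt0.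
have dvd : (p %| `|(a * d - b * c)%R| * `|(a * d + b * c)%R|)%N.
  rewrite -abszM; apply/dvdnP; exists `|(d ^+ 2 - b ^+ 2)%R|%N.
  have -> : (a * d - b * c) * (a * d + b * c) = (d ^+ 2 - b ^+ 2) * p%:Z.
    transitivity (d ^+ 2 * (a ^+ 2 + 4 * b ^+ 2) - b ^+ 2 * (c ^+ 2 + 4 * d ^+ 2)); first by ring.
    by rewrite ab cd; ring.
  by rewrite abszM.
have small (x y : int) : (p %| `|x|)%N -> y ^+ 2 + 4 * x ^+ 2 = p%:Z ^+ 2 -> x = 0.
  move=> /dvdnP [k xk] e; case: (posnP k) => [k0|k0].
    by apply/eqP; rewrite -absz_eq0 xk k0.
  have : p%:Z ^+ 2 <= x ^+ 2.
    have px : p%:Z <= `|x| by rewrite -abszE xk lez_nat leq_pmull.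
    by rewrite -[x ^+ 2]ger0_norm ?sqr_ge0 // normrX lerXn2r // nnegrE ltW.
  have := sqr_ge0 y; have : 0 < p%:Z ^+ 2 by rewrite exprn_gt0.
  by lra.
have fin : a ^+ 2 * d ^+ 2 = b ^+ 2 * c ^+ 2 -> a ^+ 2 = c ^+ 2.
  move=> e; have e2 : p%:Z * d ^+ 2 = p%:Z * b ^+ 2.
    rewrite -{1}ab -cd; transitivity (a ^+ 2 * d ^+ 2 + 4 * b ^+ 2 * d ^+ 2); first by ring.
    by rewrite e; ring.
  have := mulfI (lt0r_neq0 p0) e2 => e3.
  by move: ab cd; rewrite e3 => <-; move/addIr.
move: dvd; rewrite Euclid_dvdM // => /orP [h|h].
  have := small _ (a * c + 4 * b * d) h.
  have -> : (a * c + 4 * b * d) ^+ 2 + 4 * (a * d - b * c) ^+ 2 = p%:Z ^+ 2.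
    by rewrite [RHS]expr2 -{1}ab -cd; ring.
  move=> /(_ erefl) /eqP; rewrite subr_eq0 => /eqP e; apply: fin.
  by rewrite -!exprMn e.
have := small _ (a * c - 4 * b * d) h.
have -> : (a * c - 4 * b * d) ^+ 2 + 4 * (a * d + b * c) ^+ 2 = p%:Z ^+ 2.
  by rewrite [RHS]expr2 -{1}ab -cd; ring.
move=> /(_ erefl) /eqP; rewrite addr_eq0 => /eqP e; apply: fin.
by rewrite -!exprMn e sqrrN.
Qed.

(** * The Jacobi sum and the representation of p by two squares *)

Section JacobiSum.

Variable p : nat.
Hypothesis p_pr : prime p.
Hypothesis p_gt3 : (3 < p)%N.
Notation R := 'Z_(p ^ 2)%N.
Notation unit := GRing.unit.
Notation n := (p./2).
Notation M := (p./2./2).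
Hypothesis n_even : ~~ odd n.

Definition chi (t : 'F_p) : R := tau t ^+ M.
Definition rho (t : 'F_p) : R := tau t ^+ n.
(** The conjugate of [jac p], because the cube of [chi] is its inverse at nonzero arguments. *)
Definition jacbar : R := \sum_(t : 'F_p) chi t * rho (1 - t).

Let M0 := M_gt0 p_pr p_gt3 n_even.
Let p4 := pE4 p_pr p_gt3 n_even.
Let nM := nE p_pr p_gt3 n_even.

Lemma n_gt0 : (0 < n)%N. Proof. by lia. Qed.

Lemma chiM t u : chi (t * u) = chi t * chi u.
Proof. by rewrite /chi tauM // exprMn. Qed.

Lemma rhoM t u : rho (t * u) = rho t * rho u.
Proof. by rewrite /rho tauM // exprMn. Qed.

Lemma chi0 : chi 0 = 0.
Proof. by rewrite /chi tau0 // expr0n gtn_eqF. Qed.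

Lemma rho0 : rho 0 = 0.
Proof. by rewrite /rho tau0 // expr0n gtn_eqF ?n_gt0. Qed.

Lemma rho1 : rho 1 = 1.
Proof. by rewrite /rho tau1 // expr1n. Qed.

Lemma chi4 t : t != 0 -> chi t ^+ 4 = 1.
Proof.
move=> t0; rewrite /chi -exprM -(tau_ord p_pr t0); congr (_ ^+ _).
by rewrite {2}p4; lia.
Qed.

Lemma chi2 t : chi t ^+ 2 = rho t.
Proof. by rewrite /chi /rho -exprM {2}nM mulnC. Qed.

Lemma rho2 t : t != 0 -> rho t ^+ 2 = 1.
Proof. by move=> t0; rewrite -chi2 -exprM chi4. Qed.

Lemma jac_chi : jac p = \sum_(t : 'F_p) chi t ^+ 3 * rho (1 - t).
Proof. by apply: eq_bigr => t _; rewrite /chi /rho -exprM mulnC. Qed.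

Lemma sum_tau j : (0 < j)%N -> ~~ (p.-1 %| j)%N -> \sum_(t : 'F_p) tau t ^+ j = 0.
Proof.
move=> j0 nd; rewrite (bigD1 0) //= tau0 // expr0n gtn_eqF // add0r.
exact: psum_ndvd.
Qed.

Lemma ndvd k : (k %% 4 != 0)%N -> ~~ (p.-1 %| k * M)%N.
Proof.
have -> : (p.-1 = 4 * M)%N by have := p4; lia.
rewrite dvdn_pmul2r //; move/eqP => h; by apply/negP => h2; apply: h; apply/eqP.
Qed.

Lemma sum_rho : \sum_t rho t = 0.
Proof.
have -> : \sum_t rho t = \sum_(t : 'F_p) tau t ^+ (2 * M) by apply: eq_bigr => t _; rewrite /rho -nM.
by apply: sum_tau; [lia | exact: ndvd].
Qed.

Lemma sum_chi3 : \sum_t chi t ^+ 3 = 0.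
Proof.
have -> : \sum_t chi t ^+ 3 = \sum_(t : 'F_p) tau t ^+ (3 * M).
  by apply: eq_bigr => t _; rewrite /chi -exprM mulnC.
by apply: sum_tau; [lia | exact: ndvd].
Qed.

Lemma sum_chi3_rho : \sum_t chi t ^+ 3 * rho t = 0.
Proof.
have -> : \sum_t chi t ^+ 3 * rho t = \sum_(t : 'F_p) tau t ^+ (5 * M).
  by apply: eq_bigr => t _; rewrite -chi2 -exprD /chi -exprM mulnC.
by apply: sum_tau; [lia | exact: ndvd].
Qed.

Lemma sum_rho_quadratic (u : 'F_p) : u != 1 ->
  \sum_t rho ((1 - u * t) * (1 - t)) = - rho u.
Proof.
move=> u1.
(* The substitution t = 1 - 1/w makes the quadratic argument linear up to a square. By the
   convention that the inverse of 0 is 0, w = 0 stands for t = 1, where the summand vanishes. *)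
have inv_inj : injective (fun w : 'F_p => 1 - w^-1).
  by move=> w w' /addrI /oppr_inj /invr_inj.
rewrite (reindex_inj inv_inj) /=.
have u0 : 1 - u != 0 by rewrite subr_eq0 eq_sym.
have aff_inj : injective (fun w : 'F_p => (1 - u) * w + u).
  by move=> w w' /addIr /(mulfI u0).
have e : \sum_t rho t = rho u + \sum_(w : 'F_p | w != 0) rho ((1 - u) * w + u).
  by rewrite (reindex_inj aff_inj) (bigD1 0) //= mulr0 add0r.
have <- : \sum_(w : 'F_p | w != 0) rho ((1 - u) * w + u) = - rho u.
  by apply/eqP; rewrite -addr_eq0 addrC -e sum_rho.
rewrite (bigD1 0) //=.
rewrite invr0 subr0 subrr mulr0 rho0 add0r.
apply: eq_bigr => w w0.
have -> : (1 - u * (1 - w^-1)) * (1 - (1 - w^-1)) = ((1 - u) * w + u) * (w^-1 * w^-1).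
  by field.
have wi : w^-1 != 0 by rewrite invr_eq0.
by rewrite rhoM [rho (w^-1 * _)]rhoM -expr2 rho2 // mulr1.
Qed.

(** With u t for the variable of the first factor, [chi u ^+ 3] becomes the outer weight. The inner
    quadratic sum is p - 2 at u = 1 and -1 - rho u elsewhere, and orthogonality of characters gives
    p. *)
Lemma jac_jacbar : jac p * jacbar = p%:R.
Proof.
have -> : jac p * jacbar = \sum_u chi u ^+ 3 * \sum_(t : 'F_p | t != 0) rho ((1 - u * t) * (1 - t)).
  rewrite jac_chi /jacbar mulrC mulr_suml (bigD1 0) //= chi0 !mul0r add0r.
  transitivity (\sum_(t : 'F_p | t != 0) \sum_u chi u ^+ 3 * rho ((1 - u * t) * (1 - t))).
    apply: eq_bigr => t t0; rewrite mulr_sumr (reindex_inj (mulIf t0)) /=.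
    apply: eq_bigr => u _; rewrite chiM rhoM exprMn.
    transitivity (chi u ^+ 3 * (chi t ^+ 4) * rho (1 - u * t) * rho (1 - t)); first by ring.
    by rewrite chi4 //; ring.
  rewrite exchange_big; apply: eq_bigr => u _; by rewrite mulr_sumr.
have W u : \sum_(t : 'F_p | t != 0) rho ((1 - u * t) * (1 - t))
    = \sum_t rho ((1 - u * t) * (1 - t)) - 1.
  by rewrite [in RHS](bigD1 0) //= mulr0 !subr0 mulr1 rho1 addrC addrK.
have V1 : \sum_t rho ((1 - 1 * t) * (1 - t)) = p.-1%:R.
  have sub_inj : injective (fun w : 'F_p => 1 - w) by move=> w w' /addrI /oppr_inj.
  rewrite (reindex_inj sub_inj) (bigD1 0) //= mul1r !subr0 subrr mulr0 rho0 add0r.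
  rewrite -(@psum_dvd p p_pr 0) ?dvdn0 // /psum; apply: eq_bigr => t t0.
  by rewrite mul1r opprB addrC subrK rhoM -expr2 rho2.
rewrite (bigD1 1) //= W V1 {1}/chi tau1 // !expr1n mul1r.
rewrite (eq_bigr (fun u => - (chi u ^+ 3 * rho u) - chi u ^+ 3)); last first.
  by move=> u u1; rewrite W sum_rho_quadratic //; ring.
have : \sum_u (- (chi u ^+ 3 * rho u) - chi u ^+ 3) = 0.
  by rewrite big_split /= !sumrN sum_chi3 sum_chi3_rho oppr0 addr0.
rewrite (bigD1 1) //= {1 2}/chi tau1 // !expr1n rho1 mul1r addrC => /(canRL (addrK _)) ->.
have -> : p.-1%:R = p.-1.+1%:R - 1 :> R by rewrite -natr1 addrK.
by rewrite prednK ?prime_gt0 //; ring.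
Qed.

(** R has zero divisors, but at each stage of the factorisation of x^4 - 1 the two factors differ by
    a unit; one of them is then a unit and the other is 0. *)
Lemma root4 (x I : R) : I ^+ 2 = -1 -> x ^+ 4 = 1 -> [\/ x = 1, x = -1, x = I | x = - I].
Proof.
move=> I2 x4; have u2 := unitR2 p_pr p_gt3.
have uI : I \is a unit.
  by rewrite -(@unitrX_pos _ _ 2) // I2 unitrN unitr1.
have zero (a b : R) : a * b = 0 -> a - b \is a unit -> a = 0 \/ b = 0.
  move=> ab u; have := unitR_add p_pr u; rewrite unitrN => /orP [ua|ub].
    by right; apply: (mulrI ua); rewrite mulr0.
  by left; apply: (mulIr ub); rewrite mul0r.
have /zero : (x ^+ 2 - 1) * (x ^+ 2 + 1) = 0 by transitivity (x ^+ 4 - 1); [ring | rewrite x4 subrr].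
have -> : x ^+ 2 - 1 - (x ^+ 2 + 1) = - 2 by ring.
rewrite unitrN => /(_ u2) [h|h].
  have /zero : (x - 1) * (x + 1) = 0 by rewrite -h; ring.
  have -> : x - 1 - (x + 1) = - 2 by ring.
  rewrite unitrN => /(_ u2) [/eqP|/eqP]; rewrite ?subr_eq0 ?addr_eq0 => /eqP.
    by constructor 1.
  by constructor 2.
have /zero : (x - I) * (x + I) = 0.
  by transitivity (x ^+ 2 - I ^+ 2); [ring | rewrite I2 opprK].
have -> : x - I - (x + I) = - (2 * I) by ring.
rewrite unitrN unitrM u2 uI => /(_ isT) [/eqP|/eqP]; rewrite ?subr_eq0 ?addr_eq0 => /eqP.
  by constructor 3.
by constructor 4.
Qed.

Lemma rho_cases t : t != 0 -> rho t = 1 \/ rho t = -1.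
Proof.
move=> t0; have u2 := unitR2 p_pr p_gt3.
have e : (rho t - 1) * (rho t + 1) = 0.
  by transitivity (rho t ^+ 2 - 1); [ring | rewrite rho2 // subrr].
have := @unitR_add p p_pr (rho t + 1) (- (rho t - 1)).
have -> : rho t + 1 - (rho t - 1) = 2 by ring.
rewrite unitrN => /(_ u2) /orP [h|h].
  by left; apply/eqP; rewrite -subr_eq0; apply/eqP; apply: (mulIr h); rewrite mul0r.
by right; apply/eqP; rewrite -addr_eq0; apply/eqP; apply: (mulrI h); rewrite mulr0.
Qed.

Lemma one_neqN1 : 1 != -1 :> R.
Proof.
rewrite -addr_eq0 -[1 + 1]/(2%:R) natR_eq0 //; apply/negP => /dvdn_leq h.
have := h isT; rewrite expnS expn1; nia.
Qed.

Lemma card_sum (P : pred 'F_p) : #|P| = (\sum_t P t)%N.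
Proof. by rewrite -sum1_card big_mkcond; apply: eq_bigr => t _; rewrite unfold_in; case: (P t). Qed.

(** This supplies the parity of B in [jac_split]. The count holds modulo p^2 first, and both sides
    are too small to differ by a multiple of it. *)
Lemma count_nonsq : #|[pred t | rho t == -1]| = n.
Proof.
set N := #|_|.
have e : \sum_t (rho t + 2 * (rho t == -1)%:R) = p.-1%:R :> R.
  rewrite (bigD1 0) //= rho0 -(@psum_dvd p p_pr 0) ?dvdn0 // /psum.
  rewrite [0 == -1]eq_sym oppr_eq0 oner_eq0 mulr0 !add0r; apply: eq_bigr => t t0.
  have [-> | ->] := rho_cases t0; rewrite ?eqxx ?(negbTE one_neqN1) ?mulr0 ?addr0 ?expr0 //.
  by rewrite mulr1n; ring.
have {}e : (2 * N)%N%:R = p.-1%:R :> R.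
  rewrite -e big_split /= sum_rho add0r -mulr_sumr natrM; congr (_ * _).
  by rewrite -natr_sum /N card_sum.
have Np : (N <= p)%N by rewrite -[leqRHS](card_Fp p_pr) max_card.
have := pE p_pr p_gt3 => p2.
have pp : (2 * p < p ^ 2)%N by rewrite expnS expn1 ltn_pmul2r; lia.
have /(congr1 val) : (2 * N)%N%:R = p.-1%:R :> R by [].
rewrite /= !val_Zp_nat ?p2_gt1 // !modn_small; lia.
Qed.

(* |A| + |B| < p upgrades A^2 + B^2 = p mod p^2 to an equality of integers. *)
Lemma jac_split : exists A B : int,
  [/\ A ^+ 2 + B ^+ 2 = p%:Z, (2 %| `|B|)%N & jac p + jacbar = 2 * A%:~R].
Proof.
have [g hg] : exists g, rho g == -1.
  by apply/existsP; rewrite -[[exists _, _]]/(~~ pred0b _) -lt0n count_nonsq n_gt0.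
pose I := chi g; have I2 : I ^+ 2 = -1 by rewrite chi2; apply/eqP.
(* For t other than 0 and 1 each summand is a fourth root of unity with square rho t, hence I or -I
   exactly at nonsquares. The form of the coefficient of I records this, so that B has the parity of
   the number n of nonsquares. *)
have /fin_all_exists [c hc] : forall t : 'F_p, exists c : int * int,
  [/\ chi t ^+ 3 * rho (1 - t) = c.1%:~R + (2 * c.2 + (rho t == -1)%:Z)%:~R * I,
      chi t * rho (1 - t) = c.1%:~R - (2 * c.2 + (rho t == -1)%:Z)%:~R * I &
      `|c.1| + `|2 * c.2 + (rho t == -1)%:Z| <= ((t != 0) && (t != 1))%:Z].
  move=> t; have [-> | t0] := eqVneq t 0.
    exists (0, 0); rewrite chi0 rho0 expr0n !mul0r /= [0 == _]eq_sym oppr_eq0 oner_eq0 !mulr0.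
    by split; rewrite ?mul0r ?addr0 ?subr0.
  have [-> | t1] := eqVneq t 1.
    exists (0, 0); rewrite rho1 subrr rho0 (negbTE one_neqN1) !mulr0 addr0.
    by split; rewrite ?mul0r ?addr0 ?subr0.
  have s0 : 1 - t != 0 by rewrite subr_eq0 eq_sym.
  set x := chi t ^+ 3 * _; set y := chi t * _.
  have xy : x * y = 1.
    transitivity (chi t ^+ 4 * rho (1 - t) ^+ 2); first by rewrite /x /y; ring.
    by rewrite chi4 // rho2 // mulr1.
  have x2 : x ^+ 2 = rho t.
    rewrite /x exprMn rho2 // mulr1 -chi2.
    transitivity (chi t ^+ 4 * chi t ^+ 2); first by ring.
    by rewrite chi4 // mul1r.
  have x4 : x ^+ 4 = 1 by rewrite -[4%N]/(2 * 2)%N exprM x2 rho2.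
  rewrite -x2; have [e|e|e|e] := root4 I2 x4; rewrite e in xy *.
  - exists (1, 0); rewrite expr1n (negbTE one_neqN1) /=; move: xy; rewrite mul1r => ->.
    by split; rewrite ?mulr0 ?addr0 ?mul0r ?addr0 ?subr0.
  - exists (-1, 0); rewrite sqrrN expr1n (negbTE one_neqN1) /=.
    have -> : y = -1 by rewrite -[y]opprK -[- y]mulN1r xy.
    by split; rewrite ?mulr0 ?addr0 ?mul0r ?addr0 ?subr0.
  - exists (0, 0); rewrite I2 eqxx /=.
    have -> : y = - I by rewrite -[y]opprK -[- y]mulN1r -I2 expr2 -mulrA xy mulr1.
    by split; rewrite ?mulr0 ?add0r ?mul1r.
  - exists (0, -1); rewrite sqrrN I2 eqxx /=.
    have -> : y = I.
      by rewrite -[y]mul1r -[1]opprK -I2 expr2 mulNr -mulrA -mulrN -mulNr xy mulr1.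
    split; rewrite ?add0r //.
      by rewrite mulrN1 rmorphD rmorphN /=; ring.
    by rewrite mulrN1 rmorphD rmorphN /=; ring.
pose A := \sum_t (c t).1; pose B := \sum_t (2 * (c t).2 + (rho t == -1)%:Z).
have jA : jac p = A%:~R + B%:~R * I.
  rewrite jac_chi /A /B !rmorph_sum /= mulr_suml -big_split /=.
  by apply: eq_bigr => t _; have [] := hc t.
have jB : jacbar = A%:~R - B%:~R * I.
  rewrite /jacbar /A /B !rmorph_sum /= mulr_suml -sumrB.
  by apply: eq_bigr => t _; have [] := hc t.
exists A, B; split; last by rewrite jA jB; ring.
  have : (A ^+ 2 + B ^+ 2 - p%:Z)%:~R == 0 :> R.
    rewrite rmorphB rmorphD !rmorphXn /= -[p%:Z%:~R]/(p%:R) -jac_jacbar jA jB.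
    transitivity (B%:~R ^+ 2 * (1 + I ^+ 2) == 0 :> R); first by congr (_ == _); ring.
    by rewrite I2 subrr mulr0.
  rewrite intR_eq0 //.
  have bound : `|A| + `|B| <= p%:Z.
    apply: le_trans (_ : \sum_t (`|(c t).1| + `|2 * (c t).2 + (rho t == -1)%:Z|) <= _).
      by rewrite big_split /= lerD // ler_norm_sum.
    apply: le_trans (_ : \sum_(t : 'F_p | t != 0) 1 <= _).
      rewrite [leRHS]big_mkcond /=; apply: ler_sum => t _; have [_ _] := hc t.
      by move/le_trans; apply; case: eqP; case: eqP.
    by rewrite sumr_const card_Fp_nz // natz lez_nat leq_pred.
  have sq : A ^+ 2 + B ^+ 2 <= p%:Z ^+ 2.
    have hA := normr_ge0 A; have hB := normr_ge0 B.
    rewrite -[A ^+ 2]ger0_norm ?sqr_ge0 // -[B ^+ 2]ger0_norm ?sqr_ge0 // !normrX.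
    nia.
  have ge0 : 0 <= A ^+ 2 + B ^+ 2 by rewrite addr_ge0 ?sqr_ge0.
  move=> d; have p2 : p%:Z ^+ 2 = (p ^ 2)%N%:Z by rewrite expr2 -PoszM mulnn.
  case: (eqVneq (A ^+ 2 + B ^+ 2 - p%:Z) 0) => [/eqP|nz]; first by rewrite subr_eq0 => /eqP.
  have := dvdn_leq _ d; rewrite absz_gt0 => /(_ nz).
  nia.
have -> : B = 2 * \sum_t (c t).2 + n%:Z.
  by rewrite /B big_split /= -mulr_sumr -count_nonsq card_sum (big_morph Posz PoszD erefl).
by rewrite nM PoszM -mulrDr abszM dvdn_mulr.
Qed.

(** The Jacobi sum is a unit, so its conjugate is a multiple of p and has square 0. What remains is
    (2A)^2 - 2p, and A^2 = x^2 because B is even. *)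
Lemma jac_sq_value (x y : int) : p%:Z = x ^+ 2 + 4 * y ^+ 2 ->
  jac p ^+ 2 = 4 * x%:~R ^+ 2 - 2 * p%:R.
Proof.
move=> xy; have [A [B [AB /dvdnP [k Bk] e]]] := jac_split.
have [b Bb] : exists b, B = 2 * b.
  by exists (sgz B * k%:Z); rewrite [LHS]intEsg Bk PoszM; ring.
have AB' : A ^+ 2 + 4 * b ^+ 2 = p%:Z by rewrite -AB Bb; ring.
have Ax := two_squares_unique p_pr AB' (esym xy).
have uj : jac p \is a unit.
  have : Dfac p ^+ 2 \is a unit.
    have un := unitR_fact p_pr p_gt3 (n_small p_pr p_gt3).
    have uM := unitR_fact p_pr p_gt3 (M_small p_pr p_gt3).
    by rewrite unitrX // unitrM un unitrV unitrM uM.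
  by rewrite -(jac_sq p_pr p_gt3 n_even) unitrM unitrX_pos // => /andP [].
have jb : jacbar ^+ 2 = 0.
  apply: (mulrI (unitrX 2 uj)); rewrite mulr0 -exprMn jac_jacbar expr2.
  exact: pp0.
transitivity ((jac p + jacbar) ^+ 2 - 2 * (jac p * jacbar) - jacbar ^+ 2); first by ring.
have Ax2 : A%:~R ^+ 2 = x%:~R ^+ 2 :> R by rewrite -!rmorphXn Ax.
rewrite e jac_jacbar jb subr0 exprMn Ax2; ring.
Qed.

End JacobiSum.

(** * Clausen's identity modulo p^2 *)

Section LegendreODE.

Variables (K : comNzRingType) (s : K).

Notation q := ('X - 'X * 'X : {poly K}).

Lemma coef_derivM (Q : {poly K}) k : Q^`()`_k = k.+1%:R * Q`_k.+1.
Proof. by rewrite coef_deriv mulr_natl. Qed.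

Lemma deriv_natM m (P : {poly K}) : (m%:R * P)^`() = m%:R * P^`().
Proof. by rewrite !mulr_natl derivMn. Qed.

Lemma coef_qM (Q : {poly K}) k :
  (q * Q)`_k = (if k is j.+1 then Q`_j else 0) - (if k is j.+2 then Q`_j else 0).
Proof.
rewrite mulrBl coefB -mulrA !coefXM.
by case: k => [|[|k]] //=; rewrite coefXM.
Qed.

Lemma coef_qderiv (Q : {poly K}) k :
  (q * Q^`())`_k.+1 = k.+1%:R * Q`_k.+1 - k%:R * Q`_k.
Proof.
rewrite coef_qM coef_derivM; congr (_ - _).
by case: k => [|k]; rewrite /= ?mul0r // coef_derivM.
Qed.

Lemma legendre_ode (P : {poly K}) :
  (forall k, k.+1%:R ^+ 2 * P`_k.+1 = (k%:R * k.+1%:R - s) * P`_k) ->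
  (q * P^`())^`() + s *: P = 0.
Proof.
move=> h; apply/polyP => k.
rewrite coefD coef_derivM coefZ coef0 coef_qderiv.
transitivity (k.+1%:R ^+ 2 * P`_k.+1 - (k%:R * k.+1%:R - s) * P`_k); first by ring.
by rewrite h subrr.
Qed.

(** The symmetric square of the Legendre operator: a third-order operator that annihilates the
    squares of solutions of (q P')' + s P = 0. *)
Definition sym_square_op (Y : {poly K}) : {poly K} :=
  (q * ((q * Y^`())^`() + (2 * s) *: Y))^`() + (2 * s) *: (q * Y^`()).

Lemma sym_square_opB Y W : sym_square_op (Y - W) = sym_square_op Y - sym_square_op W.
Proof.
rewrite /sym_square_op -!mul_polyC !derivE; ring.
Qed.

Lemma sym_square_ode (P : {poly K}) :
  (q * P^`())^`() + s *: P = 0 -> sym_square_op (P ^+ 2) = 0.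
Proof.
move=> /eqP; rewrite addr_eq0 => /eqP e.
have dY : (P ^+ 2)^`() = 2 * P * P^`() by rewrite expr2 derivM; ring.
have e1 : (q * (P ^+ 2)^`())^`() = 2 * q * P^`() ^+ 2 - 2 * s%:P * P ^+ 2.
  rewrite dY; have -> : q * (2 * P * P^`()) = (q * P^`()) * (2 * P) by ring.
  rewrite derivM e -mul_polyC.
  have -> : (2 * P)^`() = 2 * P^`() by exact: deriv_natM.
  ring.
have e2 : q * ((q * (P ^+ 2)^`())^`() + (2 * s) *: P ^+ 2) = 2 * (q * P^`()) ^+ 2.
  rewrite e1 -mul_polyC rmorphM /= polyC_natr; ring.
rewrite /sym_square_op e2 dY.
have -> : (2 * (q * P^`()) ^+ 2)^`() = 4 * (q * P^`()) * (q * P^`())^`().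
  rewrite (deriv_natM 2) expr2 derivM; ring.
rewrite e -!mul_polyC rmorphM /= polyC_natr; ring.
Qed.

Lemma sym_square_comp (G : {poly K}) :
  (forall k, k.+1%:R ^+ 3 * G`_k.+1 = 2 * (2 * k%:R + 1) * (k%:R * k.+1%:R - s) * G`_k) ->
  sym_square_op (G \Po q) = 0.
Proof.
move=> h.
have dq : q^`() = 1 - 2 * 'X by rewrite derivB derivM derivX; ring.
pose G1 := 'X * G^`().
(* Chosen so that H composed with q is (q Y')' + 2 s Y for Y = G(q), using (1 - 2X)^2 = 1 - 4q. The
   recurrence of G then says (X H)' + 2 s X G' = 0. *)
pose H := (1 - 4 * 'X) * G1^`() - 2 * G1 + (2 * s) *: G.
have hH : ('X * H)^`() + (2 * s) *: G1 = 0.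
  apply/polyP => k; rewrite coefD coef_derivM coefXM /= coefZ coef0.
  have cG1 j : G1`_j = j%:R * G`_j.
    by rewrite /G1 coefXM; case: j => [|j] /=; rewrite ?mul0r // coef_derivM.
  have cX j : ('X * G1^`())`_j = j%:R * (j%:R * G`_j).
    by rewrite coefXM; case: j => [|j] /=; rewrite ?mul0r // coef_derivM cG1.
  have -> : H = G1^`() - 4 *: ('X * G1^`()) - 2 *: G1 + (2 * s) *: G.
    by rewrite /H -!mul_polyC !polyC_natr; ring.
  rewrite !coefD !coefN !coefZ cX cG1 coef_derivM cG1.
  transitivity (k.+1%:R ^+ 3 * G`_k.+1 - 2 * (2 * k%:R + 1) * (k%:R * k.+1%:R - s) * G`_k);
    last by rewrite h subrr.
  rewrite -[k.+1]addn1 natrD; ring.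
have d1 : (G \Po q)^`() = (G^`() \Po q) * (1 - 2 * 'X) by rewrite deriv_comp dq.
have e1 : q * (G \Po q)^`() = (1 - 2 * 'X) * (G1 \Po q).
  by rewrite d1 /G1 comp_polyM comp_polyX; ring.
have e2 : (q * (G \Po q)^`())^`() + (2 * s) *: (G \Po q) = H \Po q.
  rewrite e1 derivM deriv_comp dq /H.
  have -> : (1 - 2 * 'X : {poly K})^`() = - 2.
    rewrite derivB (deriv_natM 2) derivX -[1]/(1%:P) derivC; ring.
  rewrite comp_polyD comp_polyB comp_polyZ !comp_polyM comp_polyB.
  rewrite -[1 in RHS]/(1%:P) -!polyC_natr !comp_polyC comp_polyM comp_polyC comp_polyX.
  rewrite !polyC_natr; ring.
rewrite /sym_square_op e2 e1.
have -> : q * (H \Po q) = ('X * H) \Po q by rewrite comp_polyM comp_polyX.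
rewrite deriv_comp dq.
have -> : (2 * s) *: ((1 - 2 * 'X) * (G1 \Po q)) = (1 - 2 * 'X) * (((2 * s) *: G1) \Po q).
  by rewrite comp_polyZ -!mul_polyC; ring.
by rewrite mulrC -mulrDr -comp_polyD hH comp_poly0 mulr0.
Qed.

End LegendreODE.

Section Uniqueness.

Variables (F : numFieldType) (s : F).

(** Coefficient j of the equation contains coefficient j + 1 of D with the factor (j + 1)^3, and
    otherwise only lower ones; the factor is cancelled in characteristic 0. *)
Lemma sym_square_unique (D : {poly F}) : sym_square_op s D = 0 -> D`_0 = 0 -> D = 0.
Proof.
move=> ode D0; apply/polyP => j; rewrite coef0.
elim/ltn_ind: j => -[|j] IH //.
have := congr1 (fun Q : {poly F} => Q`_j) ode.
rewrite /sym_square_op coef0 coefD coef_derivM coefZ coef_qM coefD coefZ coef_derivM coef_qderiv.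
rewrite (IH j) // !mulr0 subr0 addr0.
have -> : (('X - 'X * 'X) * D^`())`_j = 0.
  by case: j IH => [|j] IH; [rewrite coef_qM subr0 | rewrite coef_qderiv !IH ?mulr0 ?subr0 //; lia].
rewrite mulr0 addr0.
have -> : (if j.+1 is i.+2 then ((('X - 'X * 'X) * D^`())^`() + (2 * s) *: D)`_i else 0) = 0.
  case: j IH => [|j] IH //.
  by rewrite coefD coefZ coef_derivM coef_qderiv !IH ?mulr0 ?subr0 ?mulr0 ?addr0 //; lia.
rewrite subr0 => /eqP; rewrite !mulf_eq0 !pnatr_eq0 /=.
by move/eqP.
Qed.

End Uniqueness.

(* With s = a(a+1) this is C(a,k) C(-1-a,k); s = -3/16 (a = -1/4) gives C(2k,k) C(4k,2k) / 64^k. *)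
Definition legc (K : comUnitRingType) (s : K) (k : nat) : K :=
  \prod_(i < k) ((i%:R * i.+1%:R - s) / i.+1%:R ^+ 2).

Definition legpoly (K : comUnitRingType) (N : nat) (s : K) : {poly K} :=
  \poly_(k < N) legc s k.

Definition clausenpoly (K : comUnitRingType) (N : nat) (s : K) : {poly K} :=
  \poly_(k < N) ('C(2 * k, k)%:R * legc s k).

Lemma legcS (K : comUnitRingType) (s : K) k : (k.+1%:R : K) \is a GRing.unit ->
  k.+1%:R ^+ 2 * legc s k.+1 = (k%:R * k.+1%:R - s) * legc s k.
Proof.
by move=> u; rewrite /legc big_ord_recr /= mulrC -mulrA mulrVK ?unitrX // mulrC.
Qed.

Lemma bin2S k : (k.+1 * 'C(2 * k.+1, k.+1) = 2 * (2 * k + 1) * 'C(2 * k, k))%N.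
Proof.
have h1 := @bin_fact (2 * k.+1) k.+1 ltac:(lia).
have h2 := @bin_fact (2 * k) k ltac:(lia).
have e1 : (2 * k.+1 - k.+1 = k.+1)%N by lia.
have e2 : (2 * k - k = k)%N by lia.
rewrite e1 in h1; rewrite e2 in h2.
have e3 : (2 * k.+1 = (2 * k).+2)%N by lia.
rewrite {2}e3 !factS -h2 in h1.
have k0 := fact_gt0 k.
apply/eqP; rewrite -(eqn_pmul2r (m := (k.+1 * k`! * k`!)%N)) ?muln_gt0 ?k0 //; apply/eqP.
move: h1; move: ('C(_, _)) ('C(2 * k, k)) (k`!) => x y z h1; nia.
Qed.

Lemma clausen_coef_rec (K : comUnitRingType) (s : K) k : (k.+1%:R : K) \is a GRing.unit ->
  k.+1%:R ^+ 3 * ('C(2 * k.+1, k.+1)%:R * legc s k.+1)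
  = 2 * (2 * k%:R + 1) * (k%:R * k.+1%:R - s) * ('C(2 * k, k)%:R * legc s k).
Proof.
move=> u; transitivity ((k.+1 * 'C(2 * k.+1, k.+1))%N%:R * (k.+1%:R ^+ 2 * legc s k.+1)).
  by rewrite natrM; ring.
by rewrite bin2S legcS // !natrM natrD natrM; ring.
Qed.

Lemma legc_vanish (F : numFieldType) (m k : nat) : (m < k)%N -> legc (m%:R * m.+1%:R : F) k = 0.
Proof.
by move=> mk; rewrite /legc (bigD1 (Ordinal mk)) //= subrr !mul0r.
Qed.

(** At s = m (m + 1) the coefficients vanish beyond k = m, so the truncations are exact; both sides
    solve the third-order equation with constant term 1. *)
Lemma clausen_nat (F : numFieldType) (m N : nat) (s : F := m%:R * m.+1%:R) : (m < N)%N ->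
  clausenpoly N s \Po ('X - 'X * 'X) = legpoly N s ^+ 2.
Proof.
move=> mN.
have u k : (k.+1%:R : F) \is a GRing.unit by rewrite unitfE pnatr_eq0.
have cP k : (legpoly N s)`_k = legc s k.
  by rewrite coef_poly; case: ltnP => // Nk; rewrite legc_vanish //; lia.
have cG k : (clausenpoly N s)`_k = 'C(2 * k, k)%:R * legc s k.
  by rewrite coef_poly; case: ltnP => // Nk; rewrite legc_vanish ?mulr0 //; lia.
apply/eqP; rewrite -subr_eq0; apply/eqP; apply: (@sym_square_unique _ s).
  rewrite sym_square_opB sym_square_comp => [|k]; last by rewrite !cG clausen_coef_rec.
  rewrite sym_square_ode ?subrr //; apply: legendre_ode => k.
  by rewrite !cP legcS.
rewrite -horner_coef0 hornerD hornerN horner_comp horner_exp.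
have -> : ('X - 'X * 'X : {poly F}).[0] = 0 by rewrite !hornerE oppr0.
rewrite !horner_coef0.
by rewrite cP cG /legc big_ord0 muln0 bin0 mul1r expr1n subrr.
Qed.

Definition legc_poly (K : comUnitRingType) (k : nat) : {poly K} :=
  \prod_(i < k) (((i%:R * i.+1%:R)%:P - 'X) * (i.+1%:R ^- 2)%:P).

Lemma horner_legc_poly (K : comUnitRingType) (s : K) k : (legc_poly K k).[s] = legc s k.
Proof. by rewrite /legc_poly horner_prod; apply: eq_bigr => i _; rewrite !hornerE. Qed.

Lemma coef_clausen_comp (K : comUnitRingType) (N j : nat) (s : K) (q : {poly K}) :
  (clausenpoly N s \Po q)`_j = \sum_(k < N) 'C(2 * k, k)%:R * legc s k * (q ^+ k)`_j.
Proof.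
rewrite /clausenpoly poly_def raddf_sum /= coef_sum; apply: eq_bigr => k _.
by rewrite comp_polyZ comp_Xn_poly coefZ.
Qed.

(** The coefficient of degree j in the difference of the two sides of Clausen's identity, as a
    polynomial in s; the conditionals reproduce the truncation in [legpoly]. *)
Definition clausen_defect (N j : nat) : {poly rat} :=
  \sum_(k < N) ('C(2 * k, k)%:R * (('X - 'X * 'X) ^+ k)`_j) *: legc_poly rat k
  - \sum_(i < j.+1) (if (i < N)%N then legc_poly rat i else 0)
      * (if (j - i < N)%N then legc_poly rat (j - i) else 0).

Lemma horner_clausen_defect (N j : nat) (s : rat) :
  (clausen_defect N j).[s] = (clausenpoly N s \Po ('X - 'X * 'X))`_j - (legpoly N s ^+ 2)`_j.
Proof.
rewrite hornerD hornerN !horner_sum coef_clausen_comp expr2 coefM; congr (_ - _).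
  by apply: eq_bigr => k _; rewrite hornerZ horner_legc_poly; ring.
apply: eq_bigr => i _; rewrite hornerM !coef_poly.
by congr (_ * _); case: ifP => _; rewrite ?horner_legc_poly ?horner0.
Qed.

(** * Integrality of the defect and its value at s = -3/16 *)

Section ClausenModp2.

Variable p : nat.
Hypothesis p_pr : prime p.
Hypothesis p_gt3 : (3 < p)%N.
Notation R := 'Z_(p ^ 2)%N.
Notation unit := GRing.unit.

Definition pintegral (x : rat) := exists r : R, reduces x r.

Lemma pintegralD x y : pintegral x -> pintegral y -> pintegral (x + y).
Proof. by move=> [r hr] [t ht]; exists (r + t); apply: reducesD. Qed.

Lemma pintegralM x y : pintegral x -> pintegral y -> pintegral (x * y).
Proof. by move=> [r hr] [t ht]; exists (r * t); apply: reducesM. Qed.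

Lemma pintegralN x : pintegral x -> pintegral (- x).
Proof. by move=> [r hr]; exists (- r); apply: reducesN. Qed.

Lemma pintegral_nat k : pintegral k%:R.
Proof. by exists k%:R; exact: reduces_nat. Qed.

Lemma pintegral_sum (I : Type) (l : seq I) (P : pred I) (f : I -> rat) :
  (forall i, P i -> pintegral (f i)) -> pintegral (\sum_(i <- l | P i) f i).
Proof. by move=> h; apply: big_ind => //; [exact: (pintegral_nat 0) | exact: pintegralD]. Qed.

Definition polyint (P : {poly rat}) := forall i, pintegral P`_i.

Lemma polyintC c : pintegral c -> polyint c%:P.
Proof. by move=> hc i; rewrite coefC; case: eqP => // _; exact: (pintegral_nat 0). Qed.

Lemma polyintX : polyint 'X.
Proof. by move=> i; rewrite coefX; exact: pintegral_nat. Qed.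

Lemma polyintD P Q : polyint P -> polyint Q -> polyint (P + Q).
Proof. by move=> hP hQ i; rewrite coefD; apply: pintegralD. Qed.

Lemma polyintN P : polyint P -> polyint (- P).
Proof. by move=> hP i; rewrite coefN; apply: pintegralN. Qed.

Lemma polyintM P Q : polyint P -> polyint Q -> polyint (P * Q).
Proof. by move=> hP hQ i; rewrite coefM; apply: pintegral_sum => j _; apply: pintegralM. Qed.

Lemma polyint_horner P x : polyint P -> pintegral x -> pintegral P.[x].
Proof.
move=> hP hx; rewrite horner_coef; apply: pintegral_sum => i _; apply: pintegralM => //.
by elim: (nat_of_ord i) => [|k IH]; [exact: (pintegral_nat 1) | rewrite exprS; apply: pintegralM].
Qed.

(** X - c is monic, so the coefficients of Q are recovered from the top downwards without
    division. *)
Lemma polyint_factor Q c : pintegral c -> polyint (Q * ('X - c%:P)) -> polyint Q.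
Proof.
move=> hc hQ.
suff h k i : (size Q <= i + k)%N -> pintegral Q`_i by move=> i; apply: (h (size Q)); lia.
elim: k i => [|k IH] i hi.
  by rewrite nth_default; [exact: (pintegral_nat 0) | rewrite addn0 in hi].
have -> : Q`_i = (Q * ('X - c%:P))`_i.+1 + c * Q`_i.+1.
  by rewrite mulrBr coefB coefMX coefMC /=; ring.
by apply: pintegralD => //; apply: pintegralM => //; apply: IH; lia.
Qed.

Lemma polyint_factors Q (l : seq rat) : (forall c, c \in l -> pintegral c) ->
  polyint (Q * \prod_(c <- l) ('X - c%:P)) -> polyint Q.
Proof.
elim: l Q => [|c l IH] Q hl; first by rewrite big_nil mulr1.
rewrite big_cons mulrA => /IH h; apply: (@polyint_factor _ c); first by apply: hl; rewrite mem_head.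
by apply: h => d dl; apply: hl; rewrite in_cons dl orbT.
Qed.


Lemma unitR_S k : (k.+1 < p)%N -> (k.+1%:R : R) \is a unit.
Proof. by move=> kp; apply: unitR_small. Qed.

Lemma reduces_legc x (r : R) k : (k < p)%N -> reduces x r -> reduces (legc x k) (legc r k).
Proof.
move=> kp xr; apply: reduces_prod => // i _; have ip := ltn_ord i.
have rn a : reduces a%:R (a%:R : R) by exact: reduces_nat.
apply: reduces_div => //.
- by rewrite unitrX // unitR_S //; lia.
- by apply: reducesB => //; apply: reducesM.
- by apply: reducesX.
Qed.

Lemma polyint_legc k : (k < p)%N -> polyint (legc_poly rat k).
Proof.
move=> kp; rewrite /legc_poly; apply: big_ind.
- by apply: polyintC; exact: (pintegral_nat 1).
- exact: polyintM.
move=> i _; have ip := ltn_ord i; apply: polyintM.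
  apply: polyintD; last exact/polyintN/polyintX.
  by apply: polyintC; apply: pintegralM; exact: pintegral_nat.
apply: polyintC; exists (i.+1%:R ^+ 2)^-1; apply: reducesV => //.
  by rewrite unitrX // unitR_S //; lia.
by apply: reducesX => //; exact: reduces_nat.
Qed.

Definition reduces_poly (P : {poly rat}) (Q : {poly R}) := forall i, reduces P`_i Q`_i.

Lemma reduces_polyM P Q P' Q' :
  reduces_poly P Q -> reduces_poly P' Q' -> reduces_poly (P * P') (Q * Q').
Proof. by move=> h h' i; rewrite !coefM; apply: reduces_sum => // j _; apply: reducesM. Qed.

Lemma reduces_polyqX k : reduces_poly (('X - 'X * 'X) ^+ k) (('X - 'X * 'X) ^+ k).
Proof.
have rX : reduces_poly 'X 'X by move=> i; rewrite !coefX; exact: reduces_nat.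
elim: k => [|k IH]; first by move=> i; rewrite !expr0 !coef1; exact: reduces_nat.
rewrite !exprS; apply: reduces_polyM IH => i; rewrite !coefB.
by apply: reducesB => //; apply: reduces_polyM.
Qed.

Lemma reduces_clausen_defect j x (r : R) : reduces x r ->
  reduces (clausen_defect p j).[x]
    ((clausenpoly p r \Po ('X - 'X * 'X))`_j - (legpoly p r ^+ 2)`_j).
Proof.
move=> xr; rewrite horner_clausen_defect; apply: reducesB => //.
  rewrite !coef_clausen_comp; apply: reduces_sum => // k _; apply: reducesM => //.
    by apply: reducesM => //; [exact: reduces_nat | exact: reduces_legc].
  exact: reduces_polyqX.
rewrite !expr2; apply: reduces_polyM => i; rewrite !coef_poly;
  by case: ltnP => // ip; [exact: reduces_legc | exact: reduces0].
Qed.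

Lemma polyint_clausen_defect j : polyint (clausen_defect p j).
Proof.
have psum n (f : 'I_n -> {poly rat}) : (forall i, polyint (f i)) -> polyint (\sum_i f i).
  move=> h; apply: big_ind => //; first by apply: polyintC; exact: (pintegral_nat 0).
  exact: polyintD.
apply: polyintD; last apply: polyintN; apply: psum => i.
  rewrite -mul_polyC; apply: polyintM; last exact: polyint_legc.
  apply: polyintC; apply: pintegralM; first exact: pintegral_nat.
  by exists (('X - 'X * 'X) ^+ i)`_j; exact: reduces_polyqX.
by apply: polyintM; case: ltnP => ip; (exact: polyint_legc || (apply: polyintC; exact: (pintegral_nat 0))).
Qed.

(** The factorisation takes place over the rationals, where the points m (m + 1) are distinct;
    modulo p those of m and p - 1 - m coincide. Monic factors keep the cofactor p-integral. *)
Lemma clausen_defect_factor j :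
  exists2 Q, polyint Q & clausen_defect p j = Q * \prod_(m < p) ('X - (m%:R * m.+1%:R)%:P).
Proof.
pose l := [seq (m%:R * m.+1%:R : rat) | m <- iota 0 p].
have ul : uniq l.
  rewrite map_inj_uniq ?iota_uniq // => a b /eqP; rewrite -!natrM eqr_nat => /eqP h; nia.
have rl : all (root (clausen_defect p j)) l.
  apply/allP => c /mapP [m]; rewrite mem_iota add0n => /andP [_ mp] ->.
  by rewrite rootE horner_clausen_defect clausen_nat // subrr.
have url : uniq_roots l by rewrite uniq_rootsE.
have [Q e] := uniq_roots_prod_XsubC rl url.
exists Q; last by rewrite e big_map -[p in iota 0 p]subn0 big_mkord.
apply: (@polyint_factors _ l); last by rewrite -e; exact: polyint_clausen_defect.
by move=> c /mapP [m _ ->]; rewrite -natrM; exact: pintegral_nat.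
Qed.

Lemma prod_two_multiples (k i0 i1 : nat) (f : nat -> R) : (i0 < k)%N -> (i1 < k)%N -> i0 != i1 ->
  (exists z, f i0 = p%:R * z) -> (exists z, f i1 = p%:R * z) -> \prod_(i < k) f i = 0.
Proof.
move=> h0 h1 ne [z0 e0] [z1 e1].
rewrite (bigD1 (Ordinal h0)) //= (bigD1 (Ordinal h1)) /=; last by rewrite -val_eqE /= eq_sym.
by rewrite e0 e1 mulrA mulrACA pp0 // !mul0r.
Qed.

Notation s0 := (- 3 / 16 : R).

Lemma unitR16 : (16 : R) \is a unit.
Proof.
have -> : (16 : R) = 2 * 2 * 2 * 2 by ring.
by rewrite !unitrM (unitR2 p_pr p_gt3).
Qed.

Lemma legendre_factor i : i%:R * i.+1%:R - s0 = (4 * i + 1)%N%:R * (4 * i + 3)%N%:R / 16.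
Proof.
apply: (mulIr unitR16); rewrite mulrVK ?unitR16 // mulrBl mulrVK ?unitR16 //.
by rewrite -natr1 !(natrD _ (4 * i)) !(natrM _ 4); ring.
Qed.

(** By [legendre_factor], one index makes 4i + 1 or 4i + 3 equal to p and another makes the other
    factor equal to 3p. The bound p - 1 instead of p is what [legc_top] uses. *)
Lemma multiples_below : exists i0 i1, [/\ (i0 < p.-1)%N, (i1 < p.-1)%N, i0 != i1,
  exists z, i0%:R * i0.+1%:R - s0 = p%:R * z & exists z, i1%:R * i1.+1%:R - s0 = p%:R * z].
Proof.
have p2 := pE p_pr p_gt3.
have [e|e] : (p = 4 * (p %/ 4) + 1 \/ p = 4 * (p %/ 4) + 3)%N by lia.
  exists (p %/ 4)%N, (3 * (p %/ 4))%N; split; try lia.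
    by exists ((4 * (p %/ 4) + 3)%N%:R / 16); rewrite legendre_factor -e mulrA.
  exists (3 * (4 * (3 * (p %/ 4)) + 1)%N%:R / 16); rewrite legendre_factor.
  have -> : (4 * (3 * (p %/ 4)) + 3 = 3 * p)%N by lia.
  by rewrite (natrM _ 3 p); ring.
exists (p %/ 4)%N, (3 * (p %/ 4) + 2)%N; split; try lia.
  by exists ((4 * (p %/ 4) + 1)%N%:R / 16); rewrite legendre_factor -e; ring.
exists (3 * (4 * (3 * (p %/ 4) + 2) + 3)%N%:R / 16); rewrite legendre_factor.
have -> : (4 * (3 * (p %/ 4) + 2) + 1 = 3 * p)%N by lia.
by rewrite (natrM _ 3 p); ring.
Qed.

Lemma reduces_s0 : reduces (- 3 / 16) s0.
Proof.
apply: reduces_div => //; first exact: unitR16; last exact: (reduces_nat p 16).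
exact: (reducesN (reduces_nat p 3)).
Qed.

(* The defect is a p-integral polynomial in s vanishing at the p points m(m+1), and for s = -3/16
   the product of the s - m(m+1) contains two multiples of p. *)
Lemma clausen_modp2 : clausenpoly p s0 \Po ('X - 'X * 'X) = legpoly p s0 ^+ 2.
Proof.
apply/polyP => j; apply/eqP; rewrite -subr_eq0; apply/eqP.
apply: (reduces_eq p_pr (reduces_clausen_defect j reduces_s0)).
have [Q iQ ->] := clausen_defect_factor j; rewrite hornerM.
have [r rQ] : pintegral Q.[- 3 / 16].
  by apply: polyint_horner => //; exists s0; exact: reduces_s0.
rewrite -(mulr0 r); apply: reducesM => //.
have -> : 0 = \prod_(m < p) (s0 - (m%:R * m.+1%:R)) :> R.
  have [i0 [i1 [h0 h1 ne [z0 e0] [z1 e1]]]] := multiples_below.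
  apply/esym/(@prod_two_multiples p i0 i1 (fun m => s0 - (m%:R * m.+1%:R))) => //; try lia.
    by exists (- z0); rewrite -opprB e0 mulrN.
  by exists (- z1); rewrite -opprB e1 mulrN.
rewrite horner_prod; apply: reduces_prod => // m _; rewrite !hornerE.
apply: reducesB => //; first exact: reduces_s0.
by apply: reducesM => //; exact: reduces_nat.
Qed.

(** Because the coefficient of index p - 1 is already 0, truncation at p respects the recurrences
    and a sum may equally stop at p - 2. *)
Lemma legc_top k : (p.-1 <= k)%N -> legc s0 k = 0.
Proof.
move=> kp; have [i0 [i1 [h0 h1 ne [z0 e0] [z1 e1]]]] := multiples_below.
apply: (@prod_two_multiples k i0 i1 (fun i => (i%:R * i.+1%:R - s0) / i.+1%:R ^+ 2)) => //; try lia.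
  by exists (z0 / i0.+1%:R ^+ 2); rewrite e0 mulrA.
by exists (z1 / i1.+1%:R ^+ 2); rewrite e1 mulrA.
Qed.

End ClausenModp2.

(** * The two sums *)

Lemma bin_natr (a b : nat) : (b <= a)%N ->
  'C(a, b)%:R = a`!%:R / (b`!%:R * (a - b)`!%:R) :> rat.
Proof.
move=> ba; rewrite -(bin_fact ba) !natrM.
by rewrite mulfK // mulf_neq0 ?fact_neq0.
Qed.

Lemma legc_binomial k :
  legc (- 3 / 16 : rat) k = ('C(2 * k, k) * 'C(4 * k, 2 * k))%N%:R / 64 ^+ k.
Proof.
have binE j : ('C(2 * j, j) * 'C(4 * j, 2 * j))%N%:R
    = (4 * j)`!%:R / ((2 * j)`!%:R * j`!%:R * j`!%:R) :> rat.
  rewrite natrM !bin_natr; try lia.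
  have -> : (2 * j - j = j)%N by lia.
  have -> : (4 * j - 2 * j = 2 * j)%N by lia.
  move: (fact_neq0 rat (2 * j)) (fact_neq0 rat j) => ? ?.
  by field; apply/andP; split.
rewrite binE; elim: k => [|k IH].
  by rewrite /legc big_ord0 !muln0 !fact0 expr0; field.
have u : (k.+1%:R : rat) \is a GRing.unit by rewrite unitfE pnatr_eq0.
have := legcS (- 3 / 16 : rat) u; rewrite {}IH.
have -> : (4 * k.+1 = 4 * k + 1 + 1 + 1 + 1)%N by lia.
have -> : (2 * k.+1 = 2 * k + 1 + 1)%N by lia.
rewrite [64 ^+ _.+1]exprS -[k.+1]addn1 !natr_factD1 !natrD1 !natrM.
have p64 : (64 : rat) ^+ k != 0 by rewrite expf_neq0.
move: (legc _ _) (fact_neq0 rat (2 * k)) (fact_neq0 rat k) (ler0n rat k) p64 => T.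
move: (64 ^+ k : rat) => c.
move: _`!%:R _`!%:R _`!%:R (k%:R : rat) => b4 b2 b1 x b2_0 b1_0 x0 c0 E.
have x1 : (x + 1) ^+ 2 != 0 by rewrite expf_neq0 //; lra.
apply: (mulfI x1); rewrite E; field.
by rewrite b2_0 b1_0 c0 /=; repeat (apply/andP; split); lra.
Qed.

Lemma sum_ord_predr (V : nmodType) (m : nat) (w : nat -> V) : (0 < m)%N ->
  \sum_(k < m) w k = \sum_(k < m.-1) w k + w m.-1.
Proof. by case: m => // m _; rewrite big_ord_recr. Qed.

Lemma sum_ord_predl (V : nmodType) (m : nat) (w : nat -> V) : (0 < m)%N ->
  \sum_(k < m) w k = w 0%N + \sum_(k < m.-1) w k.+1.
Proof. by case: m => // m _; rewrite big_ord_recl. Qed.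

(** In this and the next elimination G1, G2 and P1, P2 stand for the first two derivatives of the
    truncations G at 8/81 and P at 1/9, and A2 for the sum weighted by k^2. *)
Lemma sums_algebra1 (K : comPzRingType) (S1 G1 f h P1 : K) :
  81 * S1 = 8 * G1 -> 7 * G1 = 18 * f * P1 -> 9 * h = 9 * f + 16 * P1 ->
  81 * (7 * S1) = 81 * (f * h - f ^+ 2).
Proof.
move=> e1 e2 e3.
transitivity (7 * (81 * S1)); first by ring.
rewrite e1; transitivity (8 * (7 * G1)); first by ring.
rewrite e2; transitivity (9 * f * (9 * f + 16 * P1) - 81 * f ^+ 2); first by ring.
by rewrite -e3; ring.
Qed.

Lemma sums_algebra2 (K : comPzRingType) (S1 A2 S2 G1 G2 f h P1 P2 : K) :
  81 * S1 = 8 * G1 -> 81 ^+ 2 * A2 = 64 * G2 + 648 * G1 ->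
  3 * S2 = - 49 * A2 + 16 * S1 + 6 * f ^+ 2 ->
  7 * G1 = 18 * f * P1 -> 49 * G2 - 162 * G1 = 162 * P1 ^+ 2 + 162 * f * P2 ->
  128 * P2 + 1008 * P1 = 243 * f -> 9 * h = 9 * f + 16 * P1 ->
  81 * (81 * (6 * S2)) = 81 * (81 * (5 * f ^+ 2 + 2 * (f * h) - h ^+ 2)).
Proof.
move=> eS1 eA2 eS2 eG1 eG2 eP eh.
transitivity (2 * 81 ^+ 2 * (3 * S2)); first by ring.
rewrite eS2.
transitivity (- 98 * (81 ^+ 2 * A2) + 32 * 81 * (81 * S1) + 12 * 81 * 81 * f ^+ 2); first by ring.
rewrite eA2 eS1.
transitivity (- 128 * (49 * G2 - 162 * G1) - 112 * 81 * (7 * G1) + 12 * 81 * 81 * f ^+ 2);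
  first by ring.
rewrite eG2 eG1.
transitivity (- 256 * 81 * P1 ^+ 2 - 162 * f * (128 * P2 + 1008 * P1) + 12 * 81 * 81 * f ^+ 2);
  first by ring.
rewrite eP.
transitivity (6 * 81 * 81 * f ^+ 2 - 81 * (16 * P1) ^+ 2); first by ring.
have -> : 16 * P1 = 9 * h - 9 * f by rewrite eh; ring.
by ring.
Qed.

(** * Evaluation at 1/9 and assembly of the congruences *)

Section Assembly.

Variable p : nat.
Hypothesis p_pr : prime p.
Hypothesis p_gt3 : (3 < p)%N.
Notation R := 'Z_(p ^ 2)%N.
Notation unit := GRing.unit.
Notation n := (p./2).
Notation M := (p./2./2).
Notation s0 := (- 3 / 16 : R).
Notation P := (legpoly p s0).
Notation G := (clausenpoly p s0).
Notation f := (Tsum p (base 0 : R)).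
Notation h := (Hsum p (base 0 : R)).

Let u2 := unitR2 p_pr p_gt3.
Let u3 := unitR3 p_pr p_gt3.

Lemma unitR9 : (9 : R) \is a unit.
Proof. by have -> : (9 : R) = 3 * 3; [ring | rewrite unitrM u3]. Qed.

Lemma unitR81 : (81 : R) \is a unit.
Proof. by have -> : (81 : R) = 9 * 9; [ring | rewrite unitrM unitR9]. Qed.

Lemma unitR4 : (4 : R) \is a unit.
Proof. by have -> : (4 : R) = 2 * 2; [ring | rewrite unitrM u2]. Qed.

Lemma eq_divr (a b c d : R) : b \is a unit -> d \is a unit -> a * d = c * b -> a / b = c / d.
Proof.
move=> ub ud e; apply: (mulIr ub); rewrite mulrVK //; apply: (mulIr ud).
by rewrite e mulrAC mulrVK.
Qed.

Lemma s0E : 16 * s0 = -3.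
Proof. by rewrite mulrC mulrVK // unitR16. Qed.

Lemma trm_base k : (k < p)%N -> trm (base 0 : R) k = legc s0 k * 9^-1 ^+ k.
Proof.
move=> kp; elim: k kp => [|k IH] kp; first by rewrite trm0 /legc big_ord0 mulr1.
have uk : (k.+1%:R : R) \is a unit by exact: unitR_S.
rewrite trmS IH; last by lia.
rewrite /legc big_ord_recr /= -/(legc _ _) [9^-1 ^+ _.+1]exprS.
have -> : (base 0 - 2 * k%:R) * (base 0 - (2 * k%:R + 1)) / (18 * (2 * base 0 + 2 * k%:R + 3) * (k%:R + 1))
   = (k%:R * k.+1%:R - s0) / (9 * k.+1%:R ^+ 2) :> R.
  have e2 := base_double p_pr p_gt3 0; rewrite mul0r add0r in e2.
  have -> : 2 * base 0 + 2 * k%:R + 3 = 2 * k.+1%:R :> R by rewrite e2 -[k.+1%:R]natr1; ring.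
  have -> : (k%:R + 1 : R) = k.+1%:R by rewrite natr1.
  have u18 : (18 : R) \is a unit by have -> : (18 : R) = 2 * 9; [ring | rewrite unitrM u2 unitR9].
  apply: eq_divr; first by rewrite !unitrM u18 u2 uk.
    by rewrite unitrM unitR9 unitrX.
  apply: (mulrI unitR4).
  transitivity ((2 * base (0 : R) - 4 * k%:R) * (2 * base 0 - 4 * k%:R - 2) * (9 * k.+1%:R ^+ 2) : R); first by ring.
  rewrite e2; transitivity (9 * k.+1%:R ^+ 2 * (16 * k%:R * k.+1%:R - 16 * s0)); last by ring.
  by rewrite s0E -[k.+1%:R]natr1; ring.
rewrite invrM ?unitR9 ?unitrX //; ring.
Qed.

Lemma horner_Xderiv (N : nat) (E : nat -> R) (z : R) :
  z * (\poly_(k < N) E k)^`().[z] = \sum_(k < N) k%:R * (E k * z ^+ k).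
Proof.
have -> : z * (\poly_(k < N) E k)^`().[z] = ('X * (\poly_(k < N) E k)^`()).[z] by rewrite hornerM hornerX.
have -> : 'X * (\poly_(k < N) E k)^`() = \poly_(k < N) (k%:R * E k).
  apply/polyP => -[|k]; rewrite coefXM [RHS]coef_poly /= ?mul0r ?if_same // coef_derivM coef_poly.
  by case: ifP; rewrite ?mulr0.
by rewrite horner_poly; apply: eq_bigr => k _; rewrite mulrA.
Qed.

Let y : R := 9^-1.
Let t : R := 8 / 81.
Let v (k : nat) : R := 'C(2 * k, k)%:R * legc s0 k * t ^+ k.

Lemma yE : 9 * y = 1. Proof. by rewrite divrr // unitR9. Qed.
Lemma tE : 81 * t = 8. Proof. by rewrite mulrC mulrVK // unitR81. Qed.

Lemma y_t : y - y * y = t.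
Proof.
apply: (mulrI unitR81); rewrite tE.
transitivity (9 * (9 * y) - (9 * y) * (9 * y)); [ring | rewrite yE; ring].
Qed.

Lemma fE : f = P.[y].
Proof. by rewrite horner_poly; apply: eq_bigr => k _; rewrite trm_base. Qed.

Lemma hE : 9 * h = 9 * f + 16 * P^`().[y].
Proof.
have e2 := base_double p_pr p_gt3 0; rewrite mul0r add0r in e2.
have -> : h = f + 16 * (y * P^`().[y]).
  rewrite horner_Xderiv mulr_sumr /Hsum /Tsum -big_split /=; apply: eq_bigr => k _.
  rewrite -trm_base //.
  transitivity ((16 * k%:R + 5 * (2 * base (0 : R)) + 6) * trm (base (0 : R)) k); first by ring.
  by rewrite e2; ring.
transitivity (9 * f + 16 * (9 * y * P^`().[y])); [ring | by rewrite yE mul1r].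
Qed.

Lemma G0E : G.[t] = f ^+ 2.
Proof.
rewrite fE -horner_exp -clausen_modp2 // horner_comp !hornerE.
by rewrite y_t.
Qed.

Lemma clausen_deriv :
  (G^`() \Po ('X - 'X * 'X)) * (1 - 2 * 'X) = 2 * (P * P^`()).
Proof.
have /(congr1 (fun Q : {poly R} => Q^`())) := clausen_modp2 p_pr p_gt3.
rewrite deriv_comp derivB derivM derivX expr2 derivM => e.
transitivity ((G^`() \Po ('X - 'X * 'X)) * (1 - (1 * 'X + 'X * 1))); first by ring.
by rewrite e; ring.
Qed.

Lemma horner_q : ('X - 'X * 'X : {poly R}).[y] = t.
Proof. by rewrite !hornerE y_t. Qed.

Lemma horner_dq : (1 - 2 * 'X : {poly R}).[y] = 1 - 2 * y.
Proof. by rewrite -polyC_natr !hornerE. Qed.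

(** The factor 7 is 9 (1 - 2y) at y = 1/9, from the derivative of y (1 - y); this is how the prime 7
    becomes exceptional. *)
Lemma G1E : 7 * G^`().[t] = 18 * f * P^`().[y].
Proof.
have := congr1 (fun Q : {poly R} => 9 * Q.[y]) clausen_deriv.
rewrite /= -[2 in X in _ = X]polyC_natr !hornerM horner_comp horner_q horner_dq hornerC -fE => e.
transitivity (9 * (G^`().[t] * (1 - 2 * y))).
  transitivity (9 * G^`().[t] - 2 * (9 * y) * G^`().[t]); [rewrite yE; ring | ring].
by rewrite e; ring.
Qed.

Lemma G2E : 49 * G^`()^`().[t] - 162 * G^`().[t]
  = 162 * P^`().[y] ^+ 2 + 162 * f * P^`()^`().[y].
Proof.
have := congr1 (fun Q : {poly R} => Q^`()) clausen_deriv.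
have dq : ('X - 'X * 'X : {poly R})^`() = 1 - 2 * 'X by rewrite derivB derivM derivX; ring.
have d2 : (1 - 2 * 'X : {poly R})^`() = - 2%:P.
  by rewrite derivB (deriv_natM 2) derivX -[1]/(1%:P) derivC polyC_natr; ring.
rewrite /= derivM deriv_comp dq d2 (deriv_natM 2) derivM -[2 in X in _ = X]polyC_natr.
move=> /(congr1 (fun Q : {poly R} => 81 * Q.[y])).
rewrite /= hornerD !hornerM !horner_comp hornerN horner_q horner_dq !hornerC hornerD !hornerM -fE => e.
transitivity (81 * (2 * (P^`().[y] * P^`().[y] + f * P^`()^`().[y]))); last by ring.
rewrite -e.
transitivity ((9 - 2 * (9 * y)) ^+ 2 * G^`()^`().[t] - 162 * G^`().[t]); [rewrite yE; ring | ring].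
Qed.

(** By [legc_top] the truncated polynomial satisfies Legendre's equation without a boundary term; at
    y = 1/9 the equation is multiplied by 81 * 16. *)
Lemma legpoly_ode : 128 * P^`()^`().[y] + 1008 * P^`().[y] = 243 * f.
Proof.
have rec k : k.+1%:R ^+ 2 * P`_k.+1 = (k%:R * k.+1%:R - s0) * P`_k.
  rewrite !coef_poly; have [kp|kp] := ltnP k.+1 p.
    by rewrite ltnW // legcS //; exact: unitR_S.
  by rewrite mulr0; case: ltnP => kp'; rewrite ?mulr0 // legc_top ?mulr0 //; lia.
have := congr1 (fun Q : {poly R} => 81 * 16 * Q.[y]) (legendre_ode rec).
have dq : ('X - 'X * 'X : {poly R})^`() = 1 - 2 * 'X by rewrite derivB derivM derivX; ring.
rewrite /= derivM dq hornerD hornerZ hornerD !hornerM horner_q horner_dq horner0 mulr0 -fE => e.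
apply/eqP; rewrite -subr_eq0; apply/eqP; rewrite -[RHS]e.
transitivity (16 * (81 * t) * P^`()^`().[y] + 144 * (9 - 2 * (9 * y)) * P^`().[y] + 81 * (16 * s0) * f);
  last by ring.
by rewrite yE tE s0E; ring.
Qed.

Definition S1mod : R := \sum_(k < p) k%:R * v k.
Definition S2mod : R := \sum_(k < p.-1) v k / k.+1%:R.
Let A2 : R := \sum_(k < p) k%:R * (k%:R * v k).

Lemma S1modE : 81 * S1mod = 8 * G^`().[t].
Proof. by rewrite -tE -mulrA horner_Xderiv. Qed.

Lemma A2E : 81 ^+ 2 * A2 = 64 * G^`()^`().[t] + 648 * G^`().[t].
Proof.
have -> : A2 = t * ('X * G^`())^`().[t].
  have -> : 'X * G^`() = \poly_(k < p) (k%:R * ('C(2 * k, k)%:R * legc s0 k)).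
    apply/polyP => -[|k]; rewrite coefXM [RHS]coef_poly /= ?mul0r ?if_same // coef_derivM coef_poly.
    by case: ifP; rewrite ?mulr0.
  by rewrite horner_Xderiv; apply: eq_bigr => k _; rewrite /v; ring.
rewrite derivM derivX mul1r hornerD hornerM hornerX.
by transitivity ((81 * t) ^+ 2 * G^`()^`().[t] + 81 * (81 * t) * G^`().[t]); [ring | rewrite tE; ring].
Qed.

Lemma v_top : v p.-1 = 0.
Proof. by rewrite /v legc_top // mulr0 mul0r. Qed.

(** The term recurrence divided by k + 1. The cubic (2k + 1)(16 k (k + 1) + 3) has the value -3 at k
    = -1, and this remainder produces the term of the second sum. *)
Lemma vS k : (k.+1 < p)%N -> 81 * (k.+1%:R * (k.+1%:R * v k.+1))
  = 32 * (k%:R * (k%:R * v k)) + 16 * (k%:R * v k) + 6 * v k - 3 * (v k / k.+1%:R).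
Proof.
move=> kp; have uk : (k.+1%:R : R) \is a unit by exact: unitR_S.
apply: (mulrI uk).
have e := clausen_coef_rec s0 uk.
transitivity (81 * t * t ^+ k * (k.+1%:R ^+ 3 * ('C(2 * k.+1, k.+1)%:R * legc s0 k.+1))).
  by rewrite /v exprS; ring.
rewrite e tE.
transitivity ((2 * k%:R + 1) * (16 * k%:R * k.+1%:R - 16 * s0) * v k); first by rewrite /v; ring.
rewrite s0E.
have -> : k.+1%:R * (32 * (k%:R * (k%:R * v k)) + 16 * (k%:R * v k) + 6 * v k - 3 * (v k / k.+1%:R))
  = k.+1%:R * (32 * (k%:R * (k%:R * v k)) + 16 * (k%:R * v k) + 6 * v k) - 3 * v k * (k.+1%:R / k.+1%:R).
  by ring.
by rewrite divrr // -[k.+1%:R]natr1; ring.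
Qed.

(** Sum of [vS] over k. The index shift costs nothing: the term k = 0 of [A2] is 0, and so is v at p
    - 1. *)
Lemma S2modE : 3 * S2mod = - 49 * A2 + 16 * S1mod + 6 * f ^+ 2.
Proof.
have p0 := prime_gt0 p_pr.
have top (w : nat -> R) : w p.-1 = 0 -> \sum_(k < p) w k = \sum_(k < p.-1) w k.
  by move=> w0; rewrite sum_ord_predr // w0 addr0.
have -> : f ^+ 2 = \sum_(k < p.-1) v k.
  by rewrite -G0E horner_poly -(top v v_top).
rewrite /S1mod (top (fun k => k%:R * v k)); last by rewrite v_top mulr0.
have e : 81 * A2 = \sum_(k < p.-1) 81 * (k.+1%:R * (k.+1%:R * v k.+1)).
  by rewrite /A2 (sum_ord_predl (fun k => k%:R * (k%:R * v k))) // mul0r add0r mulr_sumr.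
have e' : A2 = \sum_(k < p.-1) k%:R * (k%:R * v k).
  by rewrite /A2 (top (fun k => k%:R * (k%:R * v k))) // v_top !mulr0.
have {}e : 81 * A2 = 32 * A2 + 16 * (\sum_(k < p.-1) k%:R * v k) + 6 * (\sum_(k < p.-1) v k) - 3 * S2mod.
  rewrite e {1}e' /S2mod !mulr_sumr -!big_split /= -sumrB; apply: eq_bigr => k _.
  by rewrite vS //; have := ltn_ord k; lia.
transitivity (32 * A2 + 16 * (\sum_(k < p.-1) k%:R * v k) + 6 * (\sum_(k < p.-1) v k) - 81 * A2).
  by rewrite e; ring.
by ring.
Qed.

Lemma S1_value : 7 * S1mod = f * h - f ^+ 2.
Proof.
by apply: (mulrI unitR81); apply: sums_algebra1 S1modE G1E hE.
Qed.

Lemma S2_value : 6 * S2mod = 5 * f ^+ 2 + 2 * (f * h) - h ^+ 2.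
Proof.
apply: (mulrI unitR81); apply: (mulrI unitR81).
exact: sums_algebra2 S1modE A2E S2modE G1E G2E legpoly_ode hE.
Qed.

Lemma term_rat k : ('C(2 * k, k) ^ 2 * 'C(4 * k, 2 * k))%N%:R / (648 ^ k)%N%:R
  = 'C(2 * k, k)%:R * legc (- 3 / 16) k * (8 / 81) ^+ k :> rat.
Proof.
rewrite legc_binomial natrX.
have -> : (648 : rat) ^+ k = 64 ^+ k / (8 / 81) ^+ k.
  by rewrite -expr_div_n; congr (_ ^+ _); field.
have c0 : (64 : rat) ^+ k != 0 by rewrite expf_neq0.
have d0 : (8 / 81 : rat) ^+ k != 0 by rewrite expf_neq0 // mulf_neq0 // invr_eq0.
move: (64 ^+ k) ((8 / 81) ^+ k) c0 d0 => c d c0 d0.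
rewrite !natrM; field; by rewrite c0 d0.
Qed.

Lemma reduces_term k : (k < p)%N ->
  reduces ('C(2 * k, k)%:R * legc (- 3 / 16) k * (8 / 81) ^+ k) (v k).
Proof.
move=> kp; apply: reducesM => //.
  apply: reducesM => //; first exact: reduces_nat.
  by apply: reduces_legc => //; exact: reduces_s0.
apply: reducesX => //; apply: reduces_div => //; first exact: unitR81.
  exact: (reduces_nat p 8).
exact: (reduces_nat p 81).
Qed.

Lemma reduces_S1 : reduces (S1 p) S1mod.
Proof.
apply: reduces_sum => // k _; rewrite -mulnA natrM -mulrA term_rat.
by apply: reducesM => //; [exact: reduces_nat | exact: reduces_term].
Qed.

Lemma reduces_S2 : reduces (S2 p) S2mod.
Proof.
apply: reduces_sum => // k _; have kp := ltn_ord k.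
rewrite invfM mulrA term_rat; apply: reduces_div => //.
- by apply: unitR_S => //; lia.
- by apply: reduces_term => //; lia.
- exact: reduces_nat.
Qed.

Lemma unit_pow4 : (2 : R) ^+ n * 2 ^+ n \is a unit.
Proof. by rewrite unitrM unitrX. Qed.

Lemma unit_Dfac : Dfac p \is a unit.
Proof.
have un := unitR_fact p_pr p_gt3 (n_small p_pr p_gt3).
have uM := unitR_fact p_pr p_gt3 (M_small p_pr p_gt3).
by rewrite /Dfac unitrM un unitrV unitrM uM.
Qed.

(** f^2 equals the square of the Jacobi sum and is a unit, so f h = p makes h a multiple of p. *)
Lemma even_case (x y' : int) : ~~ odd n -> p%:Z = x ^+ 2 + 4 * y' ^+ 2 ->
  [/\ f * h = p%:R, f ^+ 2 = 4 * x%:~R ^+ 2 - 2 * p%:R & h ^+ 2 = 0].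
Proof.
move=> on xy.
have fh : f * h = p%:R by rewrite TH_special // -signr_odd (negbTE on) expr0 mulr1.
have f2 := Tsum_sq p_pr p_gt3 on.
split => //.
  rewrite -(jac_sq_value p_pr p_gt3 on xy); apply: (mulIr unit_pow4).
  by rewrite f2 jac_sq.
have uf : f ^+ 2 \is a unit.
  have : Dfac p ^+ 2 \is a unit by rewrite unitrX // unit_Dfac.
  by rewrite -f2 unitrM => /andP [].
by apply: (mulrI uf); rewrite mulr0 -exprMn fh expr2 pp0.
Qed.

(** Here 144 D^2 = 9 C(n, M)^2 (4 (M + 1))^2 with 4 (M + 1) = p + 1. Modulo p^2 the quotient (p +
    1)^2 / 2^(p-1) is 2p + 2 - 2^(p-1), the factor in [R1]. *)
Lemma odd_case : odd n ->
  [/\ f * h = - p%:R, f ^+ 2 = 0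
     & h ^+ 2 = 9 * ((2 * p%:R + 2 - 2 ^+ n * 2 ^+ n) * 'C(n, M)%:R ^+ 2)].
Proof.
move=> on.
have fh : f * h = - p%:R by rewrite TH_special // -signr_odd on expr1 mulrN1.
have h2 := Hsum_sq p_pr p_gt3 on.
have u12 : (12 : R) \is a unit.
  by have -> : (12 : R) = 4 * 3; [ring | rewrite unitrM unitR4 u3].
have uh : h ^+ 2 \is a unit.
  have : 144 * Dfac p ^+ 2 \is a unit.
    have -> : (144 : R) = 12 * 12 by ring.
    by rewrite unitrM (unitrX 2 unit_Dfac) unitrM u12.
  by rewrite -h2 unitrM => /andP [].
split => //.
  by apply: (mulIr uh); rewrite mul0r -exprMn fh sqrrN expr2 pp0.
apply: (mulIr unit_pow4); rewrite h2.
have nM : n = (2 * M + 1)%N by lia.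
have uM := unitR_fact p_pr p_gt3 (M_small p_pr p_gt3).
have D : Dfac p = 'C(n, M)%:R * M.+1%:R.
  apply: inv_eq; first by rewrite unitrM uM.
  have := @bin_fact n M ltac:(lia).
  have -> : (n - M = M.+1)%N by lia.
  by move=> <-; rewrite factS !natrM; ring.
have M4 : 4 * M.+1%:R = ep 1 :> R.
  have e : (4 * M.+1 = p + 1)%N by have := pE p_pr p_gt3; lia.
  by rewrite -natrM e natrD /ep; ring.
transitivity (9 * 'C(n, M)%:R ^+ 2 * (4 * M.+1%:R) ^+ 2 : R); first by rewrite D; ring.
have [w hw] : exists w, (2 : R) ^+ n * 2 ^+ n = ep w by rewrite pow4_h //; eexists.
rewrite M4 epX // hw.
transitivity (9 * 'C(n, M)%:R ^+ 2 * (ep (2 - w) * ep w) : R); last by rewrite /ep; ring.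
by rewrite epM // subrK.
Qed.

End Assembly.

Lemma coprime_p7 p : prime p -> p <> 7%N -> coprime p 7.
Proof. by move=> p_pr p7; rewrite prime_coprime // dvdn_prime2 //; apply/eqP. Qed.

Theorem theorem2p10 (p : nat) :
  prime p -> p <> 2%N -> p <> 3%N -> p <> 7%N ->
  (forall x y : int, (p %% 4)%N = 1%N -> (p%:Z = x ^+ 2 + 4 * y ^+ 2)%R ->
     rat_congr p 2 (S1 p) (3 / 7 * p%:R - 4 / 7 * (x%:~R) ^+ 2)
     /\ rat_congr p 2 (S2 p) (- (40 / 3) * (y%:~R) ^+ 2 + 2 * p%:R)) /\
  ((p %% 4)%N = 3%N ->
     rat_congr p 2 (S1 p) (- (p%:R / 7))
     /\ rat_congr p 2 (S2 p) (- (3 / 2) * R1 p - p%:R / 3)).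
Proof.
move=> p_pr p2 p3 p7.
have p_gt3 : (3 < p)%N.
  by have := prime_gt1 p_pr; case: (p) p2 p3 => [|[|[|[|]]]].
have pE := pE p_pr p_gt3.
have u2 := unitR2 p_pr p_gt3; have u3 := unitR3 p_pr p_gt3.
have u7 : (7 : 'Z_(p ^ 2)%N) \is a GRing.unit by rewrite (unitR_nat p_pr 7) coprime_p7.
have u6 : (6 : 'Z_(p ^ 2)%N) \is a GRing.unit.
  by have -> : (6 : 'Z_(p ^ 2)%N) = 2 * 3; [ring | rewrite unitrM u2 u3].
have rn k : reduces k%:R (k%:R : 'Z_(p ^ 2)%N) by exact: reduces_nat.
have rd (a b : nat) : (b%:R : 'Z_(p ^ 2)%N) \is a GRing.unit ->
    reduces (a%:R / b%:R) (a%:R / b%:R : 'Z_(p ^ 2)%N).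
  by move=> ub; apply: reduces_div.
have rS1 := reduces_S1 p_pr p_gt3; have rS2 := reduces_S2 p_pr p_gt3.
have v1 := S1_value p_pr p_gt3; have v2 := S2_value p_pr p_gt3.
split.
  move=> x y pm xy.
  have on : ~~ odd p./2 by lia.
  have [fh f2 h2] := even_case p_pr p_gt3 on xy.
  rewrite {}fh {}f2 ?{}h2 in v1 v2.
  (* The second congruence is stated in y: 20 x^2 - 8p becomes 12p - 80 y^2. *)
  have xR : x%:~R ^+ 2 = p%:R - 4 * y%:~R ^+ 2 :> 'Z_(p ^ 2)%N.
    have := congr1 (fun z : int => z%:~R : 'Z_(p ^ 2)%N) xy.
    by rewrite /= rmorphD rmorphM /= !rmorphXn /= -[p%:Z%:~R]/(p%:R) => ->; ring.
  split.
    apply: (reduces_congr p_pr rS1).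
    have -> : S1mod p = 3 / 7 * p%:R - 4 / 7 * x%:~R ^+ 2.
      apply: (mulrI u7); rewrite v1.
      transitivity (3 * p%:R * (7 / 7) - 4 * x%:~R ^+ 2 * (7 / 7) : 'Z_(p ^ 2)%N); last by ring.
      by rewrite divrr //; ring.
    apply: reducesB => //; first by apply: reducesM => //; exact: (rd 3 7).
    apply: reducesM => //; first exact: (rd 4 7).
    by apply: reducesX => //; exact: reduces_int.
  apply: (reduces_congr p_pr rS2).
  have -> : S2mod p = - (40 / 3) * y%:~R ^+ 2 + 2 * p%:R.
    apply: (mulrI u6); rewrite v2 xR.
    transitivity (- 80 * (3 / 3) * y%:~R ^+ 2 + 12 * p%:R : 'Z_(p ^ 2)%N); last by ring.
    by rewrite divrr //; ring.
  apply: reducesD => //; last by apply: reducesM => //; exact: (rn 2).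
  apply: reducesM => //; last by apply: reducesX => //; exact: reduces_int.
  by apply: reducesN; exact: (rd 40 3).
move=> pm; have on : odd p./2 by lia.
have [fh f2 h2] := odd_case p_pr p_gt3 on.
rewrite {}fh {}f2 ?{}h2 in v1 v2.
split.
  apply: (reduces_congr p_pr rS1).
  have -> : S1mod p = - (p%:R / 7).
    apply: (mulrI u7); rewrite v1.
    transitivity (- (p%:R * (7 / 7)) : 'Z_(p ^ 2)%N); last by ring.
    by rewrite divrr //; ring.
  by apply: reducesN; exact: (rd p 7).
apply: (reduces_congr p_pr rS2).
pose r : 'Z_(p ^ 2)%N := (2 * p%:R + 2 - 2 ^+ p./2 * 2 ^+ p./2) * 'C(p./2, p./2./2)%:R ^+ 2.
have -> : S2mod p = - (3 / 2) * r - p%:R / 3.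
  apply: (mulrI u6); rewrite v2 -/r.
  transitivity (- 9 * r * (2 / 2) - 2 * p%:R * (3 / 3)); last by ring.
  by rewrite !divrr //; ring.
apply: reducesB => //; last exact: (rd p 3).
apply: reducesM => //; first by apply: reducesN; exact: (rd 3 2).
rewrite /R1 /r.
have -> : ((p - 1) %/ 2 = p./2)%N by lia.
have -> : (p %/ 4 = p./2./2)%N by lia.
have -> : (p - 1 = p./2 + p./2)%N by lia.
rewrite expnD natrM !natrX; apply: reducesM => //; last by apply: reducesX.
apply: reducesB => //; last by apply: reducesM => //; apply: reducesX => //; exact: (rn 2).
have -> : 2 * p%:R + 2 = (2 * p + 2)%N%:R :> 'Z_(p ^ 2)%N by rewrite natrD natrM.
exact: rn.
Qed.
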